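(* Let $\mathbb{K}$ be a number field of degree $d=[\mathbb{K}:\mathbb{Q}]$ over $\mathbb{Q}$, let $\Gamma\subseteq\mathbb{K}^*$ be a finitely generated multiplicative subgroup, and let $k\ge 1$ be an integer. Fix an integral basis $\omega_1,\ldots,\omega_d$ of the ring of integers $\mathbb{Z}_{\mathbb{K}}$ of $\mathbb{K}$. For an integer $H\ge 0$ let \[ \mathcal{A}(H)=\{u_1\omega_1+\cdots+u_d\omega_d:\ u_i\in[-H,H]\cap\mathbb{Z},\ i=1,\ldots,d\}, \] and let $Z_k(\Gamma,H)$ denote the number of $k$-tuples $(\alpha_1,\ldots,\alpha_k)\in\mathcal{A}(H)^k$ such that the equation \[ \alpha_1\vartheta_1+\cdots+\alpha_k\vartheta_k=0 \] has a solution with $\vartheta_1,\ldots,\vartheta_k\in\Gamma$. Then, as $H\to\infty$, \[ Z_k(\Gamma,H)\le H^{dk-1+o(1)}, \] where the function in the $o(1)$ term tends to $0$ as $H\to\infty$ and may depend on $\mathbb{K}$, $d$, $k$, $\Gamma$ and the chosen integral basis.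
   Context: $d$, $k$, $\Gamma$, $\mathbb{K}$ and the integral basis are fixed; only $H$ varies. *)

(* Defs.v *)
From HB Require Import structures.
From mathcomp Require Import all_boot all_order all_algebra all_field.
From mathcomp Require Import boolp.


Set Implicit Arguments.
Unset Strict Implicit.
Unset Printing Implicit Defensive.

Import GRing.Theory.
Local Open Scope ring_scope.

Definition is_alg_int (L : fieldExtType rat) (x : L) : Prop :=
  exists p : {poly int}, p \is monic /\ root (map_poly (fun z : int => z%:~R : L) p) x.

Definition integral_basis (L : fieldExtType rat) (w : 'I_(\dim {:L}%VS) -> L) : Prop :=
  forall x : L, is_alg_int x <->
    exists u : 'I_(\dim {:L}%VS) -> int, x = \sum_i (u i)%:~R * w i.

Definition in_gen_group (L : fieldExtType rat) (r : nat) (g : 'I_r -> L) (x : L) : Prop :=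
  exists e : 'I_r -> int, x = \prod_i (g i) ^ (e i).

Definition elemA (L : fieldExtType rat) (w : 'I_(\dim {:L}%VS) -> L) (H : nat)
  (v : {ffun 'I_(\dim {:L}%VS) -> 'I_(2 * H).+1}) : L :=
  \sum_i (((v i : nat)%:Z - H%:Z)%:~R) * w i.

Definition solvable_in (L : fieldExtType rat) (r : nat) (g : 'I_r -> L) (k : nat)
  (a : {ffun 'I_k -> L}) : Prop :=
  exists t : 'I_k -> L, (forall j, in_gen_group g (t j)) /\ \sum_j a j * t j = 0.

Definition Zk (L : fieldExtType rat) (w : 'I_(\dim {:L}%VS) -> L) (r : nat)
  (g : 'I_r -> L) (k H : nat) : nat :=
  size (undup
    [seq a <- [seq [ffun j => @elemA L w H (v j)]
               | v : {ffun 'I_k -> {ffun 'I_(\dim {:L}%VS) -> 'I_(2 * H).+1}} <- enum {ffun 'I_k -> {ffun 'I_(\dim {:L}%VS) -> 'I_(2 * H).+1}}]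
       | `[< @solvable_in L r g k a >] ]).

(* Main.v *)
(** Write [K = Q(t)] with [t] a root of a monic [f] in [Z[X]].  If [p] is a prime
for which [f] has a root modulo [p], then [t] maps to that root under a
reduction to [F_p], so a solvable tuple of coefficients lies in a hyperplane
over [F_p] whose equation depends only on the exponents of the [theta_j]
modulo [p - 1].  Take [m = p_1 ... p_s <= H] a product of such primes and [T] a
common multiple of the [p_i - 1]: the solvable tuples are covered by
[T^(rk)] families, each defined by one congruence modulo [m], so there are at
most [T^(rk) (2H+1)^(dk-1) (2H/m + 1)] of them.  It remains to find
[m >= H^(1-eps)] with [T <= H^eps], which is done in two steps.

Many primes: the norm form [N] of [Z[t]] on a box [[0,B)^d] is large on average,
and [ln |N(x)|] is the sum of the [v_p(N(x)) ln p].  Small [p] contribute little,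
since the zeros modulo [p^j] of a monic polynomial lie in few residue classes.
For large [p], the points of the box with [p | N(x)] fall into at most [d] prime
ideals, and two points of the same prime ideal that are close would have a
difference of norm smaller than the norm of the ideal; hence there are
[O(B^d / p)] of them, and only [O(B^d / p^2)] if [f] has no root modulo [p].
So the primes with a root have total weight [sum ln p / p >= c ln X], and
for a suitable [M] there are at least [c M / ln M] of them in [(M, 2M]].

Common codivisor: by Selberg's sieve (in large sieve form) almost all of these
[p] have a prime [l | p - 1] with [C ln M < l <= M^eps].  The cofactors
[(p - 1) / l] take at most [2M / (C ln M) + 1] values, so by the pigeonhole
principle any bounded number of these primes share a cofactor [b]; for such
primes [T] is [b] times the product of the small [l]'s. *)

Require Import Defs.
From HB Require Import structures.
From mathcomp Require Import all_boot all_order all_algebra all_fingroup all_field.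
From mathcomp Require Import boolp reals sequences exp Rstruct Rstruct_topology.
From mathcomp Require Import zify ring lra.

Section LinearEquationsInGroups.
Set Implicit Arguments.
Unset Strict Implicit.
Unset Printing Implicit Defensive.
Import Order.TTheory GRing.Theory Num.Theory.
Local Open Scope ring_scope.

(** * The norm form of a number field *)

(** A nonzero cofactor would be the determinant of an invertible minor of size n - 1, forcing the
    rank up to n - 1. *)
Lemma adj_eq0_rank (F : fieldType) n (M : 'M[F]_n) :
  (\rank M + 2 <= n)%N -> \adj M = 0.
Proof.
move=> rM; apply/matrixP => i j; rewrite !mxE /cofactor.
case: n => [|n] in M rM i j *; first by case: i.
apply/eqP; rewrite mulf_eq0 signr_eq0 /=; apply/negPn/negP => ndet.
have : row' j (col' i M) \in unitmx by rewrite unitmxE unitfE.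
rewrite -row_full_unit /row_full => /eqP rk.
have le1 : (row' j (col' i M) <= col' i M)%MS.
  apply/row_subP => k; have -> : row k (row' j (col' i M)) = row (lift j k) (col' i M).
    by apply/rowP => l; rewrite !mxE.
  exact: row_sub.
have le2 : ((col' i M)^T <= M^T)%MS.
  apply/row_subP => k; have -> : row k (col' i M)^T = row (lift i k) M^T.
    by apply/rowP => l; rewrite !mxE.
  exact: row_sub.
have := mxrankS le2; rewrite !mxrank_tr => h2.
have := leq_trans (mxrankS le1) h2; rewrite rk /= => h.
by move: rM; rewrite addn2 ltnS ltnNge h.
Qed.

(** The product of M and adj M has det M as an entry, so [p] divides det M and the identity M adj M
    = (det M) I can be divided by [p]. *)
Lemma dvdz_det_adj n (p : int) (M : 'M[int]_n.+1) :
  (forall i j, (p %| (\adj M) i j)%Z) -> p != 0 -> 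
  exists2 A : 'M[int]_n.+1, M *m A = (\det M %/ p)%Z%:M & \adj M = p *: A.
Proof.
move=> pd p0; pose A := \matrix_(i, j) ((\adj M) i j %/ p)%Z.
have adjE : \adj M = p *: A.
  by apply/matrixP => i j; rewrite !mxE mulrC divzK //; have := pd i j; rewrite mxE.
exists A => //.
have E : p *: (M *m A) = (\det M)%:M by rewrite -mul_mx_adj adjE scalemxAr.
have pdet : (p %| \det M)%Z.
  have /matrixP/(_ ord0 ord0) := E; rewrite !mxE eqxx mulr1n => <-.
  exact: dvdz_mulr.
apply/matrixP => i j; apply: (mulfI p0).
have /matrixP/(_ i j) := E; rewrite !mxE => ->.
by rewrite mulrnAr [p * _]mulrC divzK.
Qed.

(* All cofactors vanish modulo p, so adj M = p A and M A = (det M / p) I; the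
   latter scalar vanishes modulo p since M is singular modulo p. *)
Lemma sqr_dvdz_det (p : nat) (F : fieldType) n (M : 'M[int]_n.+1) :
  p \in [pchar F] -> (\rank (map_mx (intr : int -> F) M) + 2 <= n.+1)%N ->
  ((p%:Z ^+ 2) %| \det M)%Z.
Proof.
move=> chF rk; have p0 : p%:Z != 0.
  by have /andP[/prime_gt0] := chF; rewrite lt0n.
have padj i j : (p %| (\adj M) i j)%Z.
  rewrite (dvdz_pcharf chF); have := adj_eq0_rank rk.
  by rewrite -map_mx_adj => /matrixP/(_ i j); rewrite !mxE => ->.
have [A MA adjE] := dvdz_det_adj padj p0.
have pdet : (p %| \det M)%Z.
  have : p%:Z *: (M *m A) = (\det M)%:M by rewrite -mul_mx_adj adjE scalemxAr.
  move/matrixP/(_ ord0 ord0); rewrite !mxE eqxx mulr1n => <-.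
  exact: dvdz_mulr.
suff pd : (p %| (\det M %/ p)%Z)%Z.
  by rewrite -(divzK pdet) mulrC expr2 dvdz_mul // mulrC.
rewrite (dvdz_pcharf chF); apply/negPn/negP => nz.
have /(congr1 (map_mx (intr : int -> F))) := MA.
rewrite map_mxM map_scalar_mx /= => E.
suff h : (n.+1 <= \rank (map_mx (intr : int -> F) M))%N.
  by have := leq_trans (leq_add h (leqnn 2)) rk; rewrite addn2 ltnNge leqnSn.
have := mxrankM_maxl (map_mx (intr : int -> F) M) (map_mx intr A).
by rewrite E -[X in (\rank X <= _)%N]scalemx1 mxrank_scale_nz // mxrank1.
Qed.

(** A Bezout relation evaluated at [C] exhibits an inverse, since Cayley-Hamilton kills the term
    with [char_poly C]. *)
Lemma horner_mx_unit_coprime (F : fieldType) n (C : 'M[F]_n.+1) (g : {poly F}) :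
  coprimep (char_poly C) g -> horner_mx C g \in unitmx.
Proof.
case/Bezout_eq1_coprimepP => [[u v]] /= /(congr1 (horner_mx C)).
rewrite rmorphD !rmorphM /= Cayley_Hamilton mulr0 add0r rmorph1.
by move/mulmx1_unit => [].
Qed.

Lemma horner_mx_eigen (F : fieldType) n (C : 'M[F]_n.+1) (v : 'rV_n.+1) a g :
  v *m C = a *: v -> v *m horner_mx C g = g.[a] *: v.
Proof.
move=> vC; elim/poly_ind: g => [|g c IH].
  by rewrite rmorph0 horner0 scale0r mulmx0.
rewrite rmorphD rmorphM /= horner_mx_X horner_mx_C mulmxDr -mulmxE mulmxA IH.
by rewrite -scalemxAl vC scalerA hornerMXaddC scalerDl mul_mx_scalar.
Qed.

Section NormForm.

Variables (n : nat) (C : 'M[int]_n.+1).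

(* For t a root of [char_poly C], [normf x0 x] is the norm of
   x0 + x_0 t + ... + x_(n-1) t^n; the constant coordinate is kept apart because
   [normf] is a monic polynomial in it. *)
Definition genpoly (x0 : int) (x : 'I_n -> int) : {poly int} :=
  \poly_(i < n.+1) oapp x x0 (unlift ord0 (inord i : 'I_n.+1)).

Definition normf (x0 : int) (x : 'I_n -> int) : int :=
  \det (horner_mx C (genpoly x0 x)).

Lemma coef_genpoly0 x0 x : (genpoly x0 x)`_0 = x0.
Proof.
rewrite coef_poly /=; set i := inord 0; have -> : i = ord0.
  by apply: val_inj; rewrite /= inordK.
by rewrite unlift_none.
Qed.

Lemma coef_genpolyS x0 x (i : 'I_n) : (genpoly x0 x)`_i.+1 = x i.
Proof.
rewrite coef_poly ltnS ltn_ord; set j := inord _.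
have -> : j = lift ord0 i by apply: val_inj; rewrite /= inordK ?ltnS.
by rewrite liftK.
Qed.

Lemma genpolyE x0 x : genpoly x0 x = x0%:P + \sum_(i < n) x i *: 'X^(i.+1).
Proof.
rewrite /genpoly poly_def big_ord_recl /= expr0 alg_polyC; congr (_%:P + _).
  by have := coef_genpoly0 x0 x; rewrite coef_poly.
apply: eq_bigr => i _; congr (_ *: _).
by have := coef_genpolyS x0 x i; rewrite coef_poly ltnS ltn_ord.
Qed.

Lemma size_genpoly x0 x : (size (genpoly x0 x) <= n.+1)%N.
Proof. exact: size_poly. Qed.

Lemma genpolyB x0 x y0 y :
  genpoly x0 x - genpoly y0 y = genpoly (x0 - y0) (fun i => x i - y i).
Proof.
rewrite !genpolyE polyCB opprD addrACA; congr (_ + _).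
by rewrite -sumrB; apply: eq_bigr => i _; rewrite scalerBl.
Qed.

(** With A the matrix of the nonconstant part, the norm is det (x0 I + A), the characteristic
    polynomial of -A at x0. *)
Lemma normf_horner (x : 'I_n -> int) :
  exists2 P : {poly int}, P \is monic /\ size P = n.+2 &
    forall x0, normf x0 x = P.[x0].
Proof.
pose A := \sum_(i < n) x i *: C ^+ (i.+1).
exists (char_poly (- A)).
  by rewrite char_poly_monic size_char_poly.
move=> x0; rewrite /normf /char_poly -horner_evalE -det_map_mx; congr (\det _).
rewrite genpolyE rmorphD /= horner_mx_C rmorph_sum /=.
apply/matrixP => i j; rewrite !mxE horner_evalE hornerD hornerN hornerMn hornerX !hornerC.
rewrite opprK; congr (_ + _); rewrite !summxE; apply: eq_bigr => k _.
by rewrite linearZ /= rmorphXn /= horner_mx_X.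
Qed.

(** A nonzero polynomial of degree at most n is coprime over Q to the irreducible [char_poly C] of
    degree n + 1, so its value at [C] is invertible. *)
Lemma normf_neq0 x0 x :
  irreducible_poly (map_poly intr (char_poly C) : {poly rat}) ->
  genpoly x0 x != 0 -> normf x0 x != 0.
Proof.
move=> irr nz; have injQ : injective (intr : int -> rat) by exact: intr_inj.
rewrite -(inj_eq injQ) rmorph0 /normf -det_map_mx map_horner_mx /=.
rewrite -unitfE -unitmxE; apply: horner_mx_unit_coprime.
rewrite -map_char_poly; have [_ irr2] := irr.
set f := map_poly _ _ in irr irr2 *; set g := map_poly _ _.
have g0 : g != 0 by rewrite -size_poly_gt0 size_map_inj_poly // size_poly_gt0.
rewrite /coprimep; apply/negPn/negP => sz.
have := irr2 _ sz (dvdp_gcdl f g); move/eqp_size => szE.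
have := dvdp_leq g0 (dvdp_gcdr f g); rewrite szE /f size_map_inj_poly //.
rewrite size_char_poly size_map_inj_poly // => h.
by have := leq_trans h (size_genpoly _ _); rewrite ltnn.
Qed.

(** Leibniz expansion: with K bounding the entries of the powers of [C] involved, each matrix entry
    is at most (n + 1) K B, and there are (n + 1)! terms. *)
Lemma normf_bound : exists2 C0 : nat, (0 < C0)%N & forall x0 x (B : nat),
  (`|x0| <= B)%N -> (forall i, `|x i| <= B)%N ->
  (`|normf x0 x| <= C0 * B ^ n.+1)%N.
Proof.
pose K : int := 1 + \sum_(k < n.+1) \sum_i \sum_j `|(C ^+ k) i j|.
have K0 : 0 <= K by rewrite addr_ge0 // !sumr_ge0 // => *; rewrite !sumr_ge0 // => *; rewrite sumr_ge0.
have leK (k : 'I_n.+1) i j : `|(C ^+ k) i j| <= K.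
  rewrite /K (bigD1 k) //= (bigD1 i) //= (bigD1 j) //= ler_wpDl //.
  by rewrite -!addrA lerDl !addr_ge0 // !sumr_ge0 // => *; rewrite !sumr_ge0 // => *; rewrite sumr_ge0.
exists (absz ((n.+1)`!%:Z * (n.+1%:Z * K) ^+ n.+1)%R).+1 => // x0 x B hx0 hx.
rewrite -lez_nat abszE PoszM; apply: le_trans (_ : (n.+1)`!%:Z * (n.+1%:Z * K * B%:Z) ^+ n.+1 <= _); last first.
  have -> : (B ^ n.+1)%N%:Z = B%:Z ^+ n.+1 by rewrite -!natz natrX.
  rewrite exprMn mulrA ler_wpM2r ?exprn_ge0 //.
  by rewrite [leRHS]intS abszE; apply: le_trans (ler_norm _) _; rewrite lerDr.
rewrite /normf /determinant; apply: le_trans (ler_norm_sum _ _ _) _.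
apply: le_trans (_ : \sum_(s : 'S_n.+1) (n.+1%:Z * K * B%:Z) ^+ n.+1 <= _); last first.
  by rewrite sumr_const card_Sn -mulr_natl natz.
apply: ler_sum => s _; rewrite normrMsign normr_prod.
apply: le_trans (_ : \prod_(i < n.+1) (n.+1%:Z * K * B%:Z) <= _); last first.
  by rewrite prodr_const card_ord.
apply: ler_prod => i _; rewrite normr_ge0 /=.
have -> : horner_mx C (genpoly x0 x) = \sum_(k < n.+1) (genpoly x0 x)`_k *: C ^+ k.
  rewrite {1}/genpoly poly_def rmorph_sum /=; apply: eq_bigr => k _.
  by rewrite linearZ /= rmorphXn /= horner_mx_X coef_poly ltn_ord.
rewrite summxE; apply: le_trans (ler_norm_sum _ _ _) _.
rewrite -mulrA -[n.+1%:Z]natz mulr_natl -[n.+1 in X in _ <= X]card_ord -sumr_const.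
apply: ler_sum => k _; rewrite mxE normrM mulrC ler_pM ?normr_ge0 //.
have lek j : `|(genpoly x0 x)`_(nat_of_ord (j : 'I_n.+1))| <= B%:Z.
  case: (unliftP ord0 j) => [l|] ->; last by rewrite coef_genpoly0 -abszE lez_nat.
  by rewrite [nat_of_ord _]/= coef_genpolyS -abszE lez_nat.
exact: lek.
Qed.

End NormForm.

Definition has_root_mod (f : {poly int}) (p : nat) : bool :=
  [exists a : 'F_p, root (map_poly (intr : int -> 'F_p) f) a].

(* Sort the elements of norm divisible by p by a common root with f in an
   algebraic closure of F_p: there are at most n + 1 classes, stable under
   subtraction. *)
Lemma normf_root_index n (C : 'M[int]_n.+1) (p : nat) : prime p ->
  exists idx : int -> ('I_n -> int) -> 'I_n.+1, forall x0 x y0 y,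
    (p %| normf C x0 x)%Z -> (p %| normf C y0 y)%Z -> idx x0 x = idx y0 y ->
    (p %| normf C (x0 - y0) (fun i => x i - y i))%Z.
Proof.
move=> pp; have chFp := pchar_Fp pp.
have [K [phi _]] := countable_algebraic_closure 'F_p.
have chK : p \in [pchar K] by rewrite (fmorph_pchar phi).
pose red := map_poly (intr : int -> K).
have [r rE] := closed_field_poly_normal (red (char_poly C)).
have rM : red (char_poly C) = char_poly (map_mx intr C) by rewrite /red map_char_poly.
have lcE : lead_coef (red (char_poly C)) = 1.
  by apply/eqP; rewrite -[_ == 1]/(_ \is monic) rM char_poly_monic.
have {}rE : red (char_poly C) = \prod_(z <- r) ('X - z%:P) by rewrite {1}rE lcE scale1r.
have szr : size r = n.+1.
  have := congr1 (fun q : {poly K} => size q) rE.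
  by rewrite rM size_char_poly size_prod_XsubC => -[].
have dvdE x0 x : (p %| normf C x0 x)%Z =
    (\det (horner_mx (map_mx intr C) (red (genpoly x0 x))) == 0 :> K).
  by rewrite (dvdz_pcharf chK) /normf -det_map_mx map_horner_mx.
(* Without a common root [find] returns n + 1 and the index means nothing; the claim only concerns
   norms divisible by [p], where a common root exists. *)
pose idx x0 (x : 'I_n -> int) := (inord (find (root (red (genpoly x0 x))) r) : 'I_n.+1).
have has_idx x0 x : (p %| normf C x0 x)%Z -> has (root (red (genpoly x0 x))) r.
  rewrite dvdE; apply: contraTT => /hasPn nr.
  rewrite -unitfE -unitmxE; apply: horner_mx_unit_coprime; rewrite -rM.
  apply: Pdiv.ClosedField.root_coprimep => a; rewrite rE root_prod_XsubC.
  by move/nr.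
exists idx => x0 x y0 y /has_idx hx /has_idx hy /(congr1 val).
rewrite /= !inordK -?szr -?has_find // => E.
have rx := nth_find 0 hx; have ry := nth_find 0 hy; rewrite -E in ry.
have kr : (find (root (red (genpoly x0 x))) r < size r)%N by rewrite -has_find.
set a := nth 0 r _ in rx ry; have {kr} ar : a \in r by apply: mem_nth.
(* The common root [a] is an eigenvalue of the reduction of [C]; its eigenvector is killed by the
   matrix of the difference, which is thus singular modulo [p]. *)
have : eigenvalue (map_mx intr C) a.
  by rewrite eigenvalue_root_char -rM rE root_prod_XsubC.
case/eigenvalueP => v vC v0; rewrite dvdE; apply/det0P; exists v => //.
rewrite (horner_mx_eigen _ vC) -genpolyB /red rmorphB hornerD hornerN.
by rewrite (rootP rx) (rootP ry) subrr scale0r.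
Qed.

(* The kernel of the reduced matrix is stable under C; were it a line, it would
   be spanned by an eigenvector and f would have a root in F_p. *)
Lemma sqr_dvdz_normf n (C : 'M[int]_n.+1) (p : nat) x0 x : prime p ->
  ~~ has_root_mod (char_poly C) p -> (p %| normf C x0 x)%Z ->
  ((p%:Z ^+ 2)%R %| normf C x0 x)%Z.
Proof.
move=> pp nroot; have chF := pchar_Fp pp.
rewrite (dvdz_pcharf chF) /normf -det_map_mx map_horner_mx /=.
set Cp := map_mx _ C; set g := map_poly _ _ => /eqP det0.
apply: (sqr_dvdz_det chF); rewrite map_horner_mx /= -/Cp -/g.
set G := horner_mx Cp g.
have kerC : (kermx G *m Cp <= kermx G)%MS.
  apply/sub_kermxP; rewrite -mulmxA.
  have -> : Cp *m G = G *m Cp.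
    by apply: comm_mx_horner; exact: comm_mx_refl.
  by rewrite mulmxA mulmx_ker mul0mx.
have rkK := mxrank_ker G; have rG := rank_leq_row G.
rewrite addn2 ltnS ltn_neqAle.
have lt_rk : (\rank G < n.+1)%N.
  rewrite ltn_neqAle rG andbT; apply/negP => /eqP rE.
  have : G \in unitmx by rewrite -row_full_unit /row_full rE.
  by rewrite unitmxE unitfE det0 eqxx.
rewrite -ltnS lt_rk andbT; apply: contra nroot => /eqP rE.
have k1 : \rank (kermx G) = 1%N by rewrite rkK rE subSnn.
have k0 : kermx G != 0 by rewrite -mxrank_eq0 k1.
have [v vK v0] := rowV0Pn k0.
have Kv : (kermx G <= v)%MS.
  by rewrite -(geq_leqif (mxrank_leqif_sup vK)) k1 lt0n mxrank_eq0.
have /sub_rVP[a aE] : (v *m Cp <= v)%MS.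
  by apply: submx_trans Kv; apply: submx_trans (submxMr _ vK) kerC.
apply/existsP; exists a; rewrite map_char_poly -eigenvalue_root_char.
by apply/eigenvalueP; exists v.
Qed.

(** * Integral generators of the field *)

Lemma in_alg_int (L : fieldExtType rat) (z : int) : in_alg L z%:~R = z%:~R.
Proof. exact: rmorph_int. Qed.

Lemma companion_exists (f : {poly int}) n : f \is monic -> size f = n.+2 ->
  exists C : 'M[int]_n.+1, char_poly C = f.
Proof.
move=> mf sf; have := companionmxK mf; move: (companionmx f).
by rewrite sf /= => C <-; exists C.
Qed.

Lemma primitive_gen (L : fieldExtType rat) : exists t : L, <<1; t>>%VS = {:L}%VS.
Proof.
have sep : separable 1 {:L}.
  apply/separableP => y _; apply: pcharf0_separable => p.
  by rewrite pchar_lalg; apply: pchar_num.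
exists (separable_generator 1 {:L}).
by rewrite -eq_adjoin_separable_generator ?sub1v.
Qed.

Lemma integral_generator (L : fieldExtType rat) :
  exists (n : nat) (C : 'M[int]_n.+1) (t : L),
  [/\ \dim {:L} = n.+1,
      irreducible_poly (map_poly intr (char_poly C) : {poly rat}),
      root (map_poly intr (char_poly C)) t &
      forall y : L, exists (D : int) (G : {poly int}),
        D != 0 /\ D%:~R * y = (map_poly intr G).[t]].
Proof.
have [t0 t0E] := primitive_gen L.
have [n nE] : exists n, \dim {:L} = n.+1.
  by exists (\dim {:L}).-1; rewrite prednK ?adim_gt0.
have mapZ (q : {poly int}) : map_poly (in_alg L) (map_poly intr q) = map_poly intr q.
  by rewrite -map_poly_comp; apply: eq_map_poly => z; rewrite /= -in_alg_int.
have [q0 q0E] := polyOver1P (minPolyOver 1 t0).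
have deg0 : size (minPoly 1 t0) = n.+2.
  by rewrite size_minPoly; have := dim_Fadjoin 1 t0; rewrite t0E dimv1 muln1 nE => ->.
have [pz [a a0 pzE]] := rat_poly_scale q0.
have aL : (a%:~R : L) != 0 by rewrite -in_alg_int fmorph_eq0 intr_eq0.
have pz_root : root (map_poly intr pz : {poly L}) t0.
  rewrite -mapZ; have -> : map_poly intr pz = a%:~R *: q0.
    by rewrite pzE scalerA divff ?scale1r ?intr_eq0.
  by rewrite map_polyZ rootZ ?fmorph_eq0 ?intr_eq0 // -q0E root_minPoly.
have pz_lead : pz`_n.+1 = a.
  have q1 : q0`_n.+1 = 1.
    apply: (fmorph_inj (in_alg L)); rewrite -coef_map -q0E rmorph1.
    by have /monicP := monic_minPoly 1 t0; rewrite /lead_coef deg0.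
  have : (a%:~R : rat) = a%:~R * q0`_n.+1 by rewrite q1 mulr1.
  rewrite pzE coefZ coef_map /= mulrA divff ?intr_eq0 // mul1r => /intr_inj.
  by [].
have pz_size : size pz = n.+2.
  rewrite -deg0 q0E size_map_poly pzE size_scale ?invr_eq0 ?intr_eq0 //.
  by rewrite size_rat_int_poly.
pose t := a%:~R * t0.
(* Chosen so that f(a X) = a^n pz(X), where [a] is the leading coefficient of [pz]; hence t = a t0
   is a root of the monic [f]. *)
pose f : {poly int} := 'X^(n.+1) + \poly_(i < n.+1) (pz`_i * a ^+ (n - i)).
have size_f : size f = n.+2.
  by rewrite size_polyDl size_polyXn // ltnS size_poly.
have monic_f : f \is monic.
  apply/monicP; rewrite /lead_coef size_f coefD coefXn eqxx coef_poly ltnn.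
  by rewrite addr0.
have root_f : root (map_poly intr f : {poly L}) t.
  apply/rootP; rewrite rmorphD /= map_polyXn hornerD hornerXn.
  move/rootP: pz_root; rewrite (horner_coef_wide _ (_ : _ <= n.+2)%N); last first.
    by rewrite -mapZ size_map_poly size_rat_int_poly pz_size.
  rewrite big_ord_recr /= coef_map pz_lead => pz0.
  rewrite (horner_coef_wide _ (_ : _ <= n.+1)%N); last first.
    apply: leq_trans (size_poly _ _) _; exact: size_poly.
  transitivity (a%:~R ^+ n * ((\sum_(i < n.+1) (map_poly intr pz)`_i * t0 ^+ i) + a%:~R * t0 ^+ n.+1)).
    rewrite mulrDr addrC; congr (_ + _); last first.
      by rewrite /t exprMn exprSr; rewrite -mulrA.
    rewrite mulr_sumr; apply: eq_bigr => i _.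
    rewrite !coef_map coef_poly ltn_ord /= rmorphM rmorphXn /= exprMn.
    have := ltn_ord i; rewrite ltnS => lein.
    have -> : a%:~R ^+ n = a%:~R ^+ (n - i) * a%:~R ^+ i :> L by rewrite -exprD subnK.
    by ring.
  by rewrite pz0 mulr0.
have tE : <<1; t>>%VS = {:L}%VS.
  apply/eqP; rewrite -t0E eqEsubv; apply/andP; split; apply/FadjoinP/andP.
    by rewrite sub1v /t rpredM ?rpred_int ?memv_adjoin.
  have t0t : t0 = a%:~R^-1 * t by rewrite /t mulrA mulVf ?mul1r.
  by rewrite sub1v [X in X \in _]t0t rpredM ?rpredV ?rpred_int ?memv_adjoin.
have degt : size (minPoly 1 t) = n.+2.
  by rewrite size_minPoly; have := dim_Fadjoin 1 t; rewrite tE dimv1 muln1 nE => ->.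
have minE : minPoly 1 t = map_poly intr f.
  have dv : minPoly 1 t %| map_poly intr f.
    by rewrite minPoly_dvdp // -mapZ alg_polyOver.
  apply/eqP; rewrite -eqp_monic ?monic_minPoly ?monic_map //.
  rewrite -dvdp_size_eqp // degt -mapZ size_map_poly size_rat_int_poly size_f.
  by [].
have [C CE] := companion_exists monic_f size_f.
exists n, C, t; split => //.
- rewrite CE; split; first by rewrite size_rat_int_poly size_f.
  move=> q szq qf.
  have := @minPoly_irr _ _ 1%AS t (map_poly (in_alg L) q) (alg_polyOver _ _).
  rewrite minE -mapZ dvdp_map => /(_ qf) /orP[|]; first by rewrite eqp_map.
  by move/eqp_size; rewrite size_map_poly size_poly1 => E; rewrite E eqxx in szq.
- by rewrite CE.
move=> y; have := memvf y; rewrite -tE => /Fadjoin1_polyP[q ->].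
have [G [D D0 qE]] := rat_poly_scale q; exists D, G; split=> //.
have -> : map_poly intr G = map_poly (in_alg L) (D%:~R *: q).
  by rewrite -mapZ qE scalerA divff ?scale1r ?intr_eq0.
by rewrite map_polyZ hornerZ -in_alg_int.
Qed.

(** * Primes modulo which the polynomial has a root *)

Lemma card_le_fibers (X Y : finType) (T : {pred X}) (f : X -> Y) (c : nat) :
  (forall y, #|[pred x in T | f x == y]| <= c)%N -> (#|T| <= #|Y| * c)%N.
Proof.
move=> h; rewrite -sum1_card (partition_big f predT) //= -sum_nat_const.
by apply: leq_sum => y _; rewrite sum1_card; apply: h.
Qed.

Lemma dvdz_pfactor_cancel (p e j : nat) (x y : int) : prime p ->
  ((p ^ j)%N %| x * y)%Z -> ~~ ((p ^ e.+1)%N %| x)%Z -> ((p ^ (j - e))%N %| y)%Z.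
Proof.
move=> pp; have [-> _|x0] := eqVneq x 0; first by rewrite dvdz0.
have [-> *|y0] := eqVneq y 0; first by rewrite dvdz0.
rewrite !dvdzE !absz_nat abszM !pfactor_dvdn ?muln_gt0 ?absz_gt0 ?x0 //.
by rewrite lognM ?absz_gt0 // -ltnNge ltnS => h1 h2; rewrite leq_subLR (leq_trans h1) ?leq_add2r.
Qed.

(* Newton-style p-adic root counting: dividing P - P(a) by X - a costs at most
   e factors of p at every b that is not congruent to a modulo p^(e+1). *)
Lemma monic_dvd_classes (p e d : nat) : prime p ->
  forall (j : nat) (P : {poly int}) (s : seq int),
  P \is monic -> size P = d.+1 -> (d * e < j)%N ->
  pairwise (fun a b : int => ~~ ((p ^ e.+1)%N %| b - a)%Z) s ->
  all (fun a => ((p ^ j)%N %| P.[a])%Z) s -> (size s <= d)%N.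
Proof.
move=> pp; elim: d => [|d IH] j P [//|a s] mP sP jd.
  rewrite /= => _ /andP[]; have /eqP := sP.
  rewrite (size1_polyC (eq_leq sP)) hornerC.
  move: mP; rewrite monicE /lead_coef sP /= => /eqP -> _.
  rewrite dvdzE /= dvdn1 => /eqP pj1; exfalso.
  by have := ltn_expl j (prime_gt1 pp); rewrite pj1; case: j jd {pj1}.
rewrite /= => /andP[/allP ha hs] /andP[da /allP ds]; rewrite ltnS.
have : root (P - P.[a]%:P) a by rewrite /root !hornerE subrr.
case/factor_theorem => Q QE.
have PE : P = Q * ('X - a%:P) + P.[a]%:P by rewrite -QE subrK.
have Q0 : Q != 0.
  apply: contraPneq sP => Q0; rewrite PE Q0 mul0r add0r size_polyC.
  by case: (_ != 0).
have sPQ : (size (P.[a]%:P)%R < size (Q * ('X - a%:P))%R)%N.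
  rewrite size_Mmonic ?monicXsubC // size_XsubC addn2 /= ltnS.
  by rewrite (leq_trans (size_polyC_leq1 _)) // size_poly_gt0.
apply: (IH (j - e)%N Q s).
- by have := mP; rewrite PE monicE lead_coefDl // lead_coef_Mmonic ?monicXsubC.
- have := sP; rewrite PE size_polyDl // size_Mmonic ?monicXsubC // size_XsubC.
  by rewrite addn2 /= => -[].
- by rewrite ltn_subRL addnC; move: jd; rewrite mulSn addnC.
- exact: hs.
apply/allP => b bs; apply: (@dvdz_pfactor_cancel p e j (b - a)) => //; last exact: ha.
have : ((p ^ j)%N %| P.[b] - P.[a])%Z by apply: rpredB => //; apply: ds.
by rewrite {1}PE !hornerE addrK mulrC.
Qed.

(** Points of one block of length p^(e+1) are pairwise incongruent modulo p^(e+1), so each block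
    holds at most d zeros modulo p^j. *)
Lemma count_monic_dvd (p e d j B : nat) (P : {poly int}) : prime p ->
  P \is monic -> size P = d.+1 -> (d * e < j)%N ->
  (#|[pred x : 'I_B | ((p ^ j)%N %| P.[(x : nat)%:Z])%Z]|
     <= (B %/ p ^ e.+1).+1 * d)%N.
Proof.
move=> pp mP sP jd; set q := (p ^ e.+1)%N.
have q0 : (0 < q)%N by rewrite expn_gt0 prime_gt0.
pose f (x : 'I_B) : 'I_(B %/ q).+1 := inord (x %/ q).
rewrite -[X in (_ <= X * _)%N]card_ord; apply: (card_le_fibers (f := f)) => k.
rewrite cardE -(size_map (fun x : 'I_B => (x : nat)%:Z)).
apply: (monic_dvd_classes pp mP sP jd); last first.
  apply/allP => b /mapP[x]; rewrite mem_enum inE => /andP[hx _] ->; exact: hx.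
rewrite pairwise_map; set s := enum _.
have : all (fun x => f x == k) s.
  by apply/allP => x; rewrite mem_enum inE => /andP[].
have : uniq s by apply: enum_uniq.
elim: s => //= x s IH /andP[xs us] /andP[/eqP fx fs]; rewrite IH // andbT.
apply/allP => y ys /=; have /eqP fy := allP fs _ ys.
have xy : x != y by apply: contraNneq xs => ->.
have : (x %/ q = y %/ q)%N.
  have := congr1 val (etrans fx (esym fy)).
  by rewrite /= !inordK // ltnS leq_div2r // ltnW.
move=> E; apply: contra xy => dv; apply/eqP/val_inj => /=.
have : (x = y %[mod q])%N.
  apply/eqP; rewrite eq_sym; have : (y%:Z == x%:Z %[mod q])%Z by rewrite eqz_mod_dvd.
  by rewrite !modz_nat.
by rewrite (divn_eq x q) (divn_eq y q) E => /eqP; rewrite !modnMDl !modn_mod => /eqP ->.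
Qed.

(** Each of the 2T + 1 admissible values is taken at most d times. *)
Lemma count_monic_small (d B T : nat) (P : {poly int}) :
  P \is monic -> size P = d.+1 -> (0 < d)%N ->
  (#|[pred x : 'I_B | (`|P.[(x : nat)%:Z]| <= T)%N]| <= (2 * T).+1 * d)%N.
Proof.
move=> mP sP d0.
pose f (x : 'I_B) : 'I_(2 * T).+1 := inord (absz (P.[(x : nat)%:Z] + T%:Z)%R).
rewrite -[X in (_ <= X * _)%N]card_ord; apply: (card_le_fibers (f := f)) => k.
rewrite cardE -(size_map (fun x : 'I_B => (x : nat)%:Z)).
pose c : int := (k : nat)%:Z - T%:Z; pose Q := P - c%:P.
have sQ : size Q = d.+1.
  by rewrite /Q -polyCN size_polyDl // sP (leq_ltn_trans (size_polyC_leq1 _)).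
have Q0 : Q != 0 by rewrite -size_poly_gt0 sQ.
rewrite -ltnS -sQ; apply: (max_poly_roots Q0); last first.
  by rewrite map_inj_uniq ?enum_uniq // => x y [] /val_inj.
apply/allP => b /mapP[x]; rewrite mem_enum inE => /andP[hx /eqP fx] ->.
have {}hx : (`|P.[(x : nat)%:Z]| <= T)%N by [].
rewrite /root /Q /c !hornerE subr_eq0 -fx /f /=; move: (P.[_]) hx => y hx.
rewrite inordK; lia.
Qed.

Definition boxnorm n (C : 'M[int]_n.+1) (B : nat) (v : 'I_B * {ffun 'I_n -> 'I_B}) : int :=
  normf C (v.1 : nat)%:Z (fun i => (v.2 i : nat)%:Z).

Lemma boxnorm_le n (C : 'M[int]_n.+1) C0 B v :
  (forall x0 x (B : nat), (`|x0| <= B)%N -> (forall i, `|x i| <= B)%N ->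
    (`|normf C x0 x| <= C0 * B ^ n.+1)%N) ->
  (`|@boxnorm n C B v| <= C0 * B ^ n.+1)%N.
Proof. by apply => [|i]; rewrite absz_nat ltnW. Qed.

(* Cut the box into cubes of side h, with C0 (h-1)^d < p^e <= C0 h^d: two points
   of the same cube and the same class modulo p have a difference whose norm is
   divisible by p^e but smaller than p^e, hence are equal. *)
Lemma count_norm_dvd n (C : 'M[int]_n.+1) C0 (p e B : nat) : prime p ->
  irreducible_poly (map_poly intr (char_poly C) : {poly rat}) ->
  (forall x0 x (B : nat), (`|x0| <= B)%N -> (forall i, `|x i| <= B)%N ->
    (`|normf C x0 x| <= C0 * B ^ n.+1)%N) ->
  (forall x0 x, (p %| normf C x0 x)%Z -> ((p ^ e)%N %| normf C x0 x)%Z) ->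
  (#|[pred v | (@boxnorm n C B v != 0) && (p %| @boxnorm n C B v)%Z]| * p ^ e
     <= n.+1 * 2 ^ n.+1 * C0 * B ^ n.+1)%N.
Proof.
move=> pp irr bnd pe; set T := [pred v | _].
have [v0 v0T|T0] := pickP T; last by rewrite eq_card0.
have big x0 x (h : nat) : (`|x0| <= h)%N -> (forall i, `|x i| <= h)%N ->
    normf C x0 x != 0 -> (p %| normf C x0 x)%Z -> (p ^ e <= C0 * h ^ n.+1)%N.
  move=> h1 h2 nz /pe dv; apply: leq_trans (bnd _ _ _ h1 h2).
  by apply: dvdn_leq; [rewrite absz_gt0 | rewrite -[(p ^ e)%N]absz_nat -dvdzE].
have exB : exists h, (p ^ e <= C0 * h ^ n.+1)%N.
  have /andP[nz dv] := v0T; exists B; apply: big nz dv => [|i]; rewrite absz_nat ltnW //.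
have [h hle hmin] := ex_minnP exB.
have hB : (h <= B)%N.
  have /andP[nz dv] := v0T; apply: hmin.
  by apply: big nz dv => [|i]; rewrite absz_nat ltnW.
have h0 : (0 < h)%N.
  rewrite lt0n; apply/eqP => h0; move: hle; rewrite h0 exp0n // muln0.
  by rewrite leqNgt expn_gt0 prime_gt0.
have [idx idxP] := normf_root_index C pp.
pose cube (a : 'I_B) : 'I_(B %/ h).+1 := inord (a %/ h).
pose f (v : 'I_B * {ffun 'I_n -> 'I_B}) :=
  (idx (v.1 : nat)%:Z (fun i => (v.2 i : nat)%:Z), (cube v.1, [ffun i => cube (v.2 i)])).
have cubeE a b : cube a = cube b -> (`|(a : nat)%:Z - (b : nat)%:Z| <= h.-1)%N.
  have lt_cube (x : 'I_B) : (x %/ h < (B %/ h).+1)%N by rewrite ltnS leq_div2r // ltnW.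
  move/(congr1 val); rewrite /= !inordK ?lt_cube // => E.
  have := divn_eq a h; have := divn_eq b h; rewrite E.
  have := ltn_pmod a h0; have := ltn_pmod b h0.
  move: (_ %% _)%N (_ %% _)%N (_ * _)%N => r s t.
  by lia.
have finj : {in T &, injective f}.
  move=> v w /andP[vn vd] /andP[wn wd] [E1 E2 E3].
  have dv := idxP _ _ _ _ vd wd E1.
  have small : normf C ((v.1 : nat)%:Z - (w.1 : nat)%:Z)
      (fun i => (v.2 i : nat)%:Z - (w.2 i : nat)%:Z) = 0.
    apply/eqP/negPn/negP => nz.
    have /hmin : (p ^ e <= C0 * h.-1 ^ n.+1)%N.
      apply: big nz dv => [|i]; apply: cubeE => //.
      by have := congr1 (fun g : {ffun _ -> _} => g i) E3; rewrite !ffunE.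
    by rewrite leqNgt prednK // leqnn.
  have gp0 : genpoly ((v.1 : nat)%:Z - (w.1 : nat)%:Z)
      (fun i => (v.2 i : nat)%:Z - (w.2 i : nat)%:Z) = 0.
    by apply: contra_eq small => nz; apply: normf_neq0.
  case: v w {vn vd wn wd E1 E2 E3 dv small} gp0 => [v0' v] [w0 w] /= gp0.
  congr (_, _).
    have := coef_genpoly0 ((v0' : nat)%:Z - (w0 : nat)%:Z) (fun i => (v i : nat)%:Z - (w i : nat)%:Z).
    by rewrite gp0 coef0 => /eqP; rewrite eq_sym subr_eq0 => /eqP[] /val_inj.
  apply/ffunP => i.
  have := coef_genpolyS ((v0' : nat)%:Z - (w0 : nat)%:Z) (fun i => (v i : nat)%:Z - (w i : nat)%:Z) i.
  by rewrite gp0 coef0 => /eqP; rewrite eq_sym subr_eq0 => /eqP[] /val_inj.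
(* There are at most (B/h + 1)^d cubes with d classes each; p^e <= C0 h^d and (B/h + 1) h <= 2B turn
   this into the stated bound. *)
have cT : (#|T| <= n.+1 * (B %/ h).+1 ^ n.+1)%N.
  rewrite -(card_in_image finj); apply: leq_trans (max_card _) _.
  by rewrite !card_prod card_ffun !card_ord expnS.
apply: leq_trans (leq_mul cT hle) _.
have : (((B %/ h).+1 * h) ^ n.+1 <= (2 * B) ^ n.+1)%N.
  rewrite leq_exp2r // mulSn mul2n -addnn leq_add //; exact: leq_trunc_div.
rewrite !expnMn => H.
rewrite mulnACA [(_ * 2 ^ _ * C0)%N]mulnAC -[(_ * _ * 2 ^ _ * _)%N]mulnA.
by rewrite leq_mul2l H orbT.
Qed.

(** * Sums of logarithms over primes *)

Section LogSums.
Variable R : realType.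
Implicit Types (p m : nat).

(** For m = 0 this uses the convention ln 0 = 0, by which points of norm zero add nothing to the
    sums of logarithms of norms. *)
Lemma ln_nat_ge0 m : 0 <= ln (m%:R : R).
Proof. by case: m => [|m]; [rewrite ln0 | rewrite ln_ge0 // ler1n]. Qed.

Lemma ler_ln_nat m n : (0 < m)%N -> (m <= n)%N -> ln (m%:R : R) <= ln n%:R.
Proof.
move=> m0 mn; rewrite ler_ln ?posrE ?ltr0n ?ler_nat //; exact: leq_trans mn.
Qed.

Lemma ln_natM m n : (0 < m)%N -> (0 < n)%N -> ln ((m * n)%:R : R) = ln m%:R + ln n%:R.
Proof. by move=> m0 n0; rewrite natrM lnM ?posrE ?ltr0n. Qed.

Lemma ln_natX m k : (0 < m)%N -> ln ((m ^ k)%:R : R) = k%:R * ln m%:R.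
Proof. by move=> m0; rewrite natrX lnXn ?ltr0n // mulr_natl. Qed.

Lemma ln_nat_prod (I : Type) (r : seq I) (P : pred I) (F : I -> nat) :
  (forall i, P i -> (0 < F i)%N) ->
  ln ((\prod_(i <- r | P i) F i)%N%:R : R) = \sum_(i <- r | P i) ln (F i)%:R.
Proof.
move=> F0; pose K (x : nat) (y : R) := (0 < x)%N /\ ln (x%:R) = y.
suff [] : K (\prod_(i <- r | P i) F i)%N (\sum_(i <- r | P i) ln (F i)%:R) by [].
apply: (big_rec2 K); first by split; rewrite ?ln1.
by move=> i y x Pi [x0 xE]; split; rewrite ?muln_gt0 ?F0 // ln_natM ?F0 // xE.
Qed.

Lemma ln_prime_sum m W : (0 < m)%N -> (m <= W)%N ->
  ln (m%:R : R) = \sum_(0 <= p < W.+1 | prime p) (logn p m)%:R * ln p%:R.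
Proof.
move=> m0 mW; rewrite -{1}[m]partnT // (widen_partn _ mW) big_mkcond /=.
rewrite (bigID prime) /= [X in (_ * X)%N]big1 ?muln1; last first.
  by move=> p /negPf np; rewrite /logn np.
rewrite ln_nat_prod; last by move=> p /prime_gt0 p0; rewrite expn_gt0 p0.
by apply: eq_bigr => p /prime_gt0 p0; rewrite ln_natX.
Qed.

(** Compare with ln z! <= z ln z: the exponent of p <= z in z! is at least floor (z / p), hence at
    least z / (2p). *)
Lemma sum_ln_prime_div (z : nat) : (0 < z)%N ->
  \sum_(0 <= p < z.+1 | prime p) ln (p%:R : R) / p%:R <= 2 * ln z%:R.
Proof.
move=> z0; have zf : (z <= z`!)%N by case: z z0 => // z _; rewrite factS leq_pmulr ?fact_gt0.
have lnf : ln (z`!%:R : R) <= z%:R * ln z%:R.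
  rewrite -ln_natX // ler_ln_nat ?fact_gt0 // fact_prod.
  have -> : (z ^ z = \prod_(1 <= i < z.+1) z)%N by rewrite prod_nat_const_nat subn1.
  by rewrite big_nat_cond [X in (_ <= X)%N]big_nat_cond; apply: leq_prod => i /andP[/andP[]].
have : z%:R / 2 * \sum_(0 <= p < z.+1 | prime p) ln (p%:R : R) / p%:R <= ln z`!%:R.
  rewrite (ln_prime_sum (fact_gt0 z) (leqnn _)).
  rewrite [leRHS](@big_cat_nat _ _ _ z.+1) //= ?ltnS // -[leLHS]addr0.
  apply: lerD; last by apply: sumr_ge0 => p _; rewrite mulr_ge0 ?ln_nat_ge0.
  rewrite mulr_sumr [leLHS]big_nat_cond [leRHS]big_nat_cond.
apply: ler_sum => p /andP[/andP[_ pz] pp].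
  have p0 := prime_gt0 pp.
  rewrite mulrCA [leRHS]mulrC ler_wpM2l ?ln_nat_ge0 //.
  have h1 : (z %/ p <= logn p z`!)%N.
    by rewrite logn_fact // big_ltn // expn1 leq_addr.
  apply: le_trans (_ : (z %/ p)%:R <= _); last by rewrite ler_nat.
  rewrite mulrAC ler_pdivrMr // ler_pdivrMr ?ltr0n // -!natrM ler_nat.
  have := ltn_ceil z p0; have : (0 < z %/ p)%N by rewrite divn_gt0.
  by move: (z %/ p)%N => q q0; nia.
move=> h; have z0' : 0 < (z%:R : R) by rewrite ltr0n.
rewrite -(ler_pM2l (_ : 0 < z%:R / 2)) ?divr_gt0 //.
by apply: le_trans h _; apply: le_trans lnf _; lra.
Qed.

Lemma sum_geom_le p J : (1 < p)%N ->
  \sum_(e < J) ((p ^ e.+1)%:R : R)^-1 <= 2 / p%:R.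
Proof.
move=> p1; have p0 : 0 < (p%:R : R) by rewrite ltr0n ltnW.
have p2 : (2 : R) <= p%:R by rewrite ler_nat.
have p2' : (p%:R : R)^-1 * 2 <= 1 by rewrite ler_pdivrMl // mulr1.
elim: J => [|J IH]; first by rewrite big_ord0 divr_ge0.
rewrite big_ord_recl /= expn1.
have -> : \sum_(i < J) ((p ^ (bump 0 i).+1)%:R : R)^-1 =
    p%:R^-1 * \sum_(e < J) ((p ^ e.+1)%:R : R)^-1.
  by rewrite mulr_sumr; apply: eq_bigr => i _; rewrite /bump /= add1n expnS natrM invfM.
rewrite [2 / _]mulrDl -[X in _ <= X]/(_ + _) mul1r lerD2l.
rewrite -[leRHS]mulr1 ler_pM2l ?invr_gt0 //; apply: le_trans IH _.
by rewrite mulrC.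
Qed.

Lemma sum_divn_blocks (g : nat -> R) d J : (0 < d)%N -> (forall e, 0 <= g e) ->
  \sum_(j < J) g (j %/ d)%N <= d%:R * \sum_(e < J) g e.
Proof.
move=> d0 g0.
have h K : \sum_(0 <= j < d * K) g (j %/ d)%N = d%:R * \sum_(e < K) g e.
  elim: K => [|K IH]; first by rewrite muln0 big_geq // big_ord0 mulr0.
  rewrite mulnS addnC (@big_cat_nat _ _ _ (d * K)) ?leq_addr //= IH.
  rewrite big_ord_recr /= mulrDr; congr (_ + _).
  rewrite -[X in bigop.body _ (index_iota X _)]add0n big_addn addKn.
  rewrite (eq_big_nat _ _ (F2 := fun=> g K)).
    by rewrite big_const_nat iter_addr_0 subn0 mulr_natl.
  by move=> i /andP[_ id]; rewrite addnC mulnC divnMDl // divn_small // addn0.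
rewrite -h -(big_mkord predT (fun j => g (j %/ d)%N)).
rewrite [leRHS](@big_cat_nat _ _ _ J) ?leq_pmull //= lerDl.
by apply: sumr_ge0.
Qed.

(** The valuation counts the exponents 1 <= i <= J with p^i dividing the value. For i = j + 1 the
    zeros are counted with e = floor (j / d), the largest e with d e <= j. The block counts sum to a
    geometric series, and their J extra blocks give the term in ln W. *)
Lemma sum_logn_monic (p d B W : nat) (P : {poly int}) : prime p ->
  P \is monic -> size P = d.+1 -> (0 < d)%N -> (0 < W)%N ->
  (forall x : 'I_B, `|P.[(x : nat)%:Z]| <= W)%N ->
  (\sum_(x < B) logn p `|P.[(x : nat)%:Z]|%N)%:R * ln p%:R <=
    2 * d%:R ^+ 2 * B%:R * (ln p%:R / p%:R) + d%:R * ln W%:R :> R.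
Proof.
move=> pp mP sP d0 W0 PW; have p1 := prime_gt1 pp.
set J := trunc_log p W.
have JW : J%:R * ln p%:R <= ln W%:R :> R.
  rewrite -ln_natX ?ler_ln_nat ?expn_gt0 ?prime_gt0 //.
  by have /andP[] := trunc_log_bounds p1 W0.
have h1 : (\sum_(x < B) logn p `|P.[(x : nat)%:Z]|%N <=
    \sum_(j < J) (B %/ p ^ (j %/ d).+1).+1 * d)%N.
  apply: leq_trans (_ : \sum_(x < B) \sum_(j < J)
      (((p ^ j.+1)%N %| P.[(x : nat)%:Z])%Z : nat) <= _)%N.
    apply: leq_sum => x _; set m := `|_|%N.
    have [->|m0] := posnP m; first by rewrite logn0.
    have lJ : (logn p m <= J)%N.
      by rewrite trunc_log_max // (leq_trans _ (PW x)) // dvdn_leq // pfactor_dvdnn.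
    rewrite -[leqLHS]card_ord -sum1_card (big_ord_widen_cond J predT (fun=> 1%N) lJ) /=.
    rewrite big_mkcond /=; apply: leq_sum => j _; case: ifP => // jl.
    by rewrite dvdzE absz_nat -/m pfactor_dvdn // jl.
  rewrite exchange_big /=; apply: leq_sum => j _.
  rewrite -big_mkcond sum1_card; apply: count_monic_dvd => //.
  by rewrite ltnS mulnC leq_trunc_div.
apply: le_trans (_ : (\sum_(j < J) (B %/ p ^ (j %/ d).+1).+1 * d)%N%:R * ln p%:R <= _).
  by rewrite ler_wpM2r ?ln_nat_ge0 // ler_nat.
have h2 : ((\sum_(j < J) (B %/ p ^ (j %/ d).+1).+1 * d)%N%:R : R) <=
    d%:R * (B%:R * (d%:R * (2 / p%:R)) + J%:R).
  rewrite natr_sum; apply: le_trans (_ : \sum_(j < J)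
     (d%:R * (B%:R * ((p ^ (j %/ d).+1)%:R)^-1 + 1)) <= _).
    apply: ler_sum => j _; rewrite natrM mulrC ler_wpM2l // -addn1 natrD lerD2r.
    by rewrite ler_pdivlMr ?ltr0n ?expn_gt0 ?prime_gt0 // -natrM ler_nat leq_trunc_div.
  rewrite -mulr_sumr ler_wpM2l // big_split /= sumr_const card_ord lerD2r -mulr_sumr.
  rewrite ler_wpM2l //; apply: le_trans (sum_divn_blocks (g := fun e => ((p ^ e.+1)%:R)^-1) _ d0 _) _.
    by move=> e; rewrite invr_ge0.
  by rewrite ler_wpM2l // sum_geom_le.
apply: le_trans (ler_wpM2r (ln_nat_ge0 p) h2) _.
have : d%:R * (J%:R * ln p%:R) <= d%:R * ln W%:R :> R by rewrite ler_wpM2l.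
set a := ln p%:R; set b := _^-1; move: a b => a b h; nra.
Qed.

End LogSums.

(** * Average size of the norm over a box *)

Section SplitMass.
Variable R : realType.
Variables (n : nat) (C : 'M[int]_n.+1) (C0 : nat).
Hypothesis irr : irreducible_poly (map_poly intr (char_poly C) : {poly rat}).
Hypothesis bnd : forall x0 x (B : nat), (`|x0| <= B)%N ->
  (forall i, `|x i| <= B)%N -> (`|normf C x0 x| <= C0 * B ^ n.+1)%N.
Local Notation d := n.+1.
Local Notation f := (char_poly C).

Lemma sum_box (B : nat) (F : 'I_B -> {ffun 'I_n -> 'I_B} -> R) :
  \sum_(v : 'I_B * {ffun 'I_n -> 'I_B}) F v.1 v.2 = \sum_(x : {ffun 'I_n -> 'I_B}) \sum_x0 F x0 x.
Proof. by rewrite exchange_big /= pair_bigA. Qed.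

(** On each line in the constant coordinate the norm is a monic polynomial of degree d, so at most
    (2T + 1) d <= B / 2 points have norm at most T = floor (B / (8d)); each of the others
    contributes at least ln (B / (8d)). *)
Lemma sum_ln_box_ge (B : nat) : (8 * d <= B)%N ->
  (B ^ d)%:R / 2 * (ln B%:R - ln (8 * d)%:R) <=
  \sum_v ln (`|@boxnorm n C B v|%N%:R : R).
Proof.
move=> dB; have B0 : (0 < B)%N by apply: leq_trans dB.
pose F (x0 : 'I_B) (x : {ffun 'I_n -> 'I_B}) : R := ln `|@boxnorm n C B (x0, x)|%N%:R.
rewrite (eq_bigr (fun v => F v.1 v.2)); last by case.
rewrite sum_box expnS natrM.
have -> : B%:R * (B ^ n)%:R / 2 * (ln B%:R - ln (8 * d)%:R) =
    \sum_(x : {ffun 'I_n -> 'I_B}) (B%:R / 2 * (ln B%:R - ln (8 * d)%:R)) :> R.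
  by rewrite sumr_const card_ffun !card_ord -mulr_natl; ring.
apply: ler_sum => x _.
have [P [mP sP] PE] := normf_horner C (fun i => (x i : nat)%:Z).
pose T := (B %/ (8 * d))%N.
have TB : (T * (8 * d) <= B)%N by apply: leq_trunc_div.
pose small := [pred x0 : 'I_B | (`|P.[(x0 : nat)%:Z]| <= T)%N].
have cs : (#|small| <= (2 * T).+1 * d)%N by apply: count_monic_small.
have cb : (B <= 2 * #|predC small|)%N.
  have := cardC small; rewrite card_ord; move: cs; rewrite -/small.
  move: #|small| #|predC small| => a b; nia.
have lnT : 0 <= ln B%:R - ln (8 * d)%:R :> R by rewrite subr_ge0 ler_ln_nat.
apply: le_trans (_ : #|predC small|%:R * (ln B%:R - ln (8 * d)%:R) <= _).
  by rewrite ler_wpM2r // ler_pdivrMr // mulrC -natrM ler_nat.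
rewrite mulr_natl -sumr_const [leRHS](bigID (predC small)) /= -[leLHS]addr0.
apply: lerD; last by apply: sumr_ge0 => *; apply: ln_nat_ge0.
apply: ler_sum => x0; rewrite !inE -ltnNge => hT.
rewrite lerBlDr -ln_natM //; last first.
  by rewrite /boxnorm PE; apply: leq_trans hT.
rewrite ler_ln_nat // /boxnorm PE /=.
have := ltn_ceil B (_ : 0 < 8 * d)%N; move/(_ isT)/ltnW => h.
by apply: leq_trans h _; rewrite leq_mul2r hT orbT.
Qed.

(* A lower bound for the residue degrees of the primes above p. *)
Definition res_exp (p : nat) : nat := if has_root_mod f p then 1 else 2.

(** Only points of nonzero norm divisible by p count, each at most J times because p^(J+1) exceeds
    every norm; [count_norm_dvd] bounds their number. *)
Lemma sum_logn_box_large (B p J : nat) : prime p ->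
  (C0 * B ^ d < p ^ J.+1)%N ->
  (\sum_v logn p `|@boxnorm n C B v|%N)%:R <=
   (J * (d * 2 ^ d * C0 * B ^ d))%:R / (p ^ res_exp p)%:R :> R.
Proof.
move=> pp WJ; have p0 := prime_gt0 pp.
rewrite ler_pdivlMr ?ltr0n ?expn_gt0 ?p0 // -natrM ler_nat.
have pe x0 x : (p %| normf C x0 x)%Z -> ((p ^ res_exp p)%N %| normf C x0 x)%Z.
  rewrite /res_exp; case: ifPn => [_|nr] dv; first by rewrite expn1.
  by have := sqr_dvdz_normf pp nr dv; rewrite -natz -natrX natz.
have := @count_norm_dvd n C C0 p _ B pp irr bnd pe.
set T := [pred v | _] => hT.
apply: leq_trans (_ : J * #|T| * p ^ res_exp p <= _)%N; last first.
  by rewrite -mulnA leq_mul2l hT orbT.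
rewrite leq_mul2r; apply/orP; right.
rewrite mulnC -sum_nat_const [leqRHS]big_mkcond; apply: leq_sum => v _.
case: ifPn; rewrite /= ?negb_and ?negbK.
  case/andP => nz _; rewrite -ltnS -(ltn_exp2l _ _ (prime_gt1 pp)).
  apply: leq_ltn_trans WJ; apply: leq_trans (boxnorm_le v bnd).
  by rewrite dvdn_leq ?absz_gt0 // pfactor_dvdnn.
case/orP => [/eqP -> | ndv]; first by rewrite logn0.
by rewrite leqn0 lognE; case: ifP => // /and3P[_ _ dv]; rewrite dvdzE /= dv in ndv.
Qed.

(** Primes up to z are handled on each of the B^n lines in the constant coordinate by
    [sum_logn_monic], larger ones on the whole box by [sum_logn_box_large]. *)
Lemma sum_ln_box_le (B z J : nat) : (0 < B)%N -> (0 < z)%N -> (z <= C0 * B ^ d)%N ->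
  (C0 * B ^ d < z ^ J.+1)%N ->
  \sum_v ln (`|@boxnorm n C B v|%N%:R : R) <=
  (B ^ d)%:R * (4 * d%:R ^+ 2 * ln z%:R + z%:R * (d%:R * ln (C0 * B ^ d)%:R) / B%:R) +
  (J * (d * 2 ^ d * C0 * B ^ d))%:R *
    \sum_(z.+1 <= p < (C0 * B ^ d).+1 | prime p) ln p%:R / (p ^ res_exp p)%:R.
Proof.
move=> B0 z0; set W := (C0 * B ^ d)%N => zW WJ.
have W0 : (0 < W)%N by apply: leq_trans zW.
have lnE (v : 'I_B * {ffun 'I_n -> 'I_B}) : ln (`|boxnorm C v|%N%:R : R) =
    \sum_(0 <= p < W.+1 | prime p) (logn p `|boxnorm C v|%N)%:R * ln p%:R.
  have [->|nz] := eqVneq (boxnorm C v) 0.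
    by rewrite big1 ?ln0 // => p _; rewrite logn0 mul0r.
  by apply: ln_prime_sum; rewrite ?absz_gt0 //; exact: boxnorm_le.
rewrite (eq_bigr _ (fun v _ => lnE v)) exchange_big /=.
rewrite (@big_cat_nat _ _ _ z.+1) //=.
apply: lerD; last first.
  rewrite mulr_sumr [leLHS]big_nat_cond [leRHS]big_nat_cond.
  apply: ler_sum => p /andP[/andP[zp pW] pp].
  rewrite -mulr_suml -natr_sum [leLHS]mulrC [leRHS]mulrCA.
  rewrite ler_wpM2l ?ln_nat_ge0 //; apply: sum_logn_box_large => //.
  apply: leq_trans WJ _; rewrite leq_exp2r // ltnW //.
apply: le_trans (_ : \sum_(0 <= p < z.+1 | prime p)
  (B ^ n)%:R * (2 * d%:R ^+ 2 * B%:R * (ln p%:R / p%:R) + d%:R * ln W%:R) <= _).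
  apply: ler_sum => p pp; rewrite -mulr_suml.
  rewrite (eq_bigr (fun v : 'I_B * {ffun 'I_n -> 'I_B} =>
    (logn p `|boxnorm C (v.1, v.2)|%N)%:R)); last by case.
  rewrite (sum_box (fun x0 x => (logn p `|boxnorm C (x0, x)|%N)%:R)) mulr_suml.
  have -> : (B ^ n)%:R = #|{: {ffun 'I_n -> 'I_B}}|%:R :> R by rewrite card_ffun !card_ord.
  rewrite mulr_natl -sumr_const; apply: ler_sum => x _.
  have [P [mP sP] PE] := normf_horner C (fun i => (x i : nat)%:Z).
  rewrite -natr_sum (eq_bigr (fun x0 : 'I_B => logn p `|P.[(x0 : nat)%:Z]|%N)); last first.
    by move=> x0 _; rewrite /boxnorm PE.
  apply: sum_logn_monic => // x0.
  by have := @boxnorm_le n C C0 B (x0, x) bnd; rewrite /boxnorm PE.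
rewrite -mulr_sumr big_split /= -mulr_sumr expnS [(B * _)%N]mulnC natrM -[leRHS]mulrA.
rewrite ler_wpM2l // mulrDr; apply: lerD.
  have -> : B%:R * (4 * d%:R ^+ 2 * ln z%:R) = 2 * d%:R ^+ 2 * B%:R * (2 * ln z%:R) :> R by ring.
  by rewrite ler_wpM2l ?mulr_ge0 ?exprn_ge0 // sum_ln_prime_div.
have -> : B%:R * (z%:R * (d%:R * ln W%:R) / B%:R) = z%:R * (d%:R * ln W%:R) :> R.
  by rewrite mulrC divfK // pnatr_eq0 -lt0n.
rewrite big_ltn_cond //= big_mkcond /=.
apply: le_trans (_ : \sum_(1 <= p < z.+1) d%:R * ln W%:R <= _).
  apply: ler_sum => p _; case: ifP => // _; rewrite mulr_ge0 ?ln_nat_ge0 //.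
by rewrite big_const_nat iter_addr_0 subn1 [leRHS]mulr_natl.
Qed.

(** Telescoping, from 1/p^2 <= 1/(p - 1) - 1/p. *)
Lemma sum_inv_sqr_gt (z W : nat) : (0 < z)%N ->
  \sum_(z.+1 <= p < W) ((p ^ 2)%:R : R)^-1 <= z%:R^-1.
Proof.
move=> z0; have [Wz|zW] := leqP W z; first by rewrite big_geq ?invr_ge0 // leqW.
suff : \sum_(z.+1 <= p < W) ((p ^ 2)%:R : R)^-1 <= z%:R^-1 - W.-1%:R^-1.
  by move/le_trans; apply; rewrite gerBl invr_ge0.
elim: W zW => // W IH; rewrite ltnS leq_eqVlt => /orP[/eqP <-|zW].
  by rewrite big_geq // subrr.
rewrite big_nat_recr //=; apply: le_trans (lerD (IH zW) (lexx _)) _.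
have w1 : (1 <= W.-1)%N by rewrite -ltnS prednK ?(leq_ltn_trans _ zW) // (leq_ltn_trans z0 zW).
rewrite -(prednK (ltn_trans w1 (_ : W.-1 < W)%N)); last by rewrite prednK // (leq_trans _ zW).
move: (W.-1) w1 => w w0; rewrite /=.
have w0' : 0 < (w%:R : R) by rewrite ltr0n.
rewrite natrX -addn1 natrD.
have -> : w%:R^-1 = (w%:R + 1)^-1 + (w%:R * (w%:R + 1))^-1 :> R.
  by field; rewrite !gt_eqF ?addr_gt0.
have : ((w%:R + 1) ^+ 2)^-1 <= (w%:R * (w%:R + 1))^-1 :> R.
  rewrite lef_pV2 ?posrE ?mulr_gt0 ?exprn_gt0 ?addr_gt0 //.
  by rewrite expr2 ler_wpM2r ?addr_ge0 ?ler_wpDr // ltW.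
lra.
Qed.

End SplitMass.

Section SplitCount.
Variable R : realType.

Lemma ln_nat_unbounded (E : R) : exists z0 : nat, forall z, (z0 <= z)%N -> E <= ln z%:R.
Proof.
exists (Num.truncn (expR E)).+1 => z zz.
have z0 : (0 < z)%N by apply: leq_trans zz.
rewrite -[E]expRK ler_ln ?posrE ?expR_gt0 ?ltr0n //.
apply: le_trans (ltW (truncnS_gt _)) _; by rewrite ler_nat.
Qed.

Lemma ln_nat_le (z : nat) : ln (z%:R : R) <= z%:R.
Proof.
by case: z => [|z]; [rewrite ln0 | apply: ltW; apply: ln_sublinear; rewrite ltr0n].
Qed.

Variables (n : nat) (C : 'M[int]_n.+1).
Hypothesis irr : irreducible_poly (map_poly intr (char_poly C) : {poly rat}).
Local Notation d := n.+1.
Local Notation f := (char_poly C).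

(** Compare both estimates for the box of side B = z^Kz: primes up to z cannot account for the
    average of ln |N|, and primes without a root contribute a bounded amount, so the remaining mass
    comes from primes with a root. *)
Lemma split_mass : exists (c : R) (K z0 : nat), 0 < c /\ forall z, (z0 <= z)%N ->
  c * ln z%:R <= \sum_(z.+1 <= p < (z ^ K).+1 | prime p && has_root_mod f p) ln p%:R / p%:R.
Proof.
have [C0 C00 bnd] := normf_bound C.
(* Then (ln B) / 2 = 16 d^2 ln z dominates the contribution 4 d^2 ln z of the small primes; all
   norms are at most C0 z^J < z^(J+1). *)
pose Kz := (32 * d ^ 2)%N; pose J := (Kz * d)%N.
have J0 : (0 < J)%N by rewrite !muln_gt0.
pose A : R := (J * (d * 2 ^ d * C0))%:R.
have A0 : 0 < A by rewrite ltr0n muln_gt0 J0 !muln_gt0 C00 expn_gt0.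
pose E : R := ln (8 * d)%:R / 2 + d%:R * J.+1%:R + A * J.+1%:R.
have [z1 z1P] := ln_nat_unbounded E.
exists A^-1, J.+1, (maxn z1 (maxn C0.+1 (8 * d))); split; first by rewrite invr_gt0.
move=> z; rewrite !geq_max => /and3P[/z1P lE zC zd].
have z0 : (0 < z)%N by apply: leq_trans zC.
pose B := (z ^ Kz)%N; pose W := (C0 * B ^ d)%N.
have B0 : (0 < B)%N by rewrite expn_gt0 z0.
have zB : (z ^ 2 <= B)%N by rewrite leq_pexp2l // /Kz (leq_trans _ (leq_pmulr _ _)) ?expn_gt0.
have zB1 : (z <= B)%N by apply: leq_trans zB; rewrite -{1}[z]expn1 leq_pexp2l.
have WJ : (W < z ^ J.+1)%N.
  by rewrite /W /B -expnM -/J expnS ltn_pmul2r // expn_gt0 z0.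
have zW : (z <= W)%N.
  rewrite /W; apply: leq_trans zB1 _; rewrite expnS mulnCA leq_pmulr //.
  by rewrite muln_gt0 C00 expn_gt0 B0.
have W0 : (0 < W)%N by apply: leq_trans zW.
have lnW : ln W%:R <= J.+1%:R * ln z%:R :> R.
  by rewrite -ln_natX // ler_ln_nat // ltnW.
have := le_trans (@sum_ln_box_ge R n C B (leq_trans zd zB1)) (sum_ln_box_le R irr bnd B0 z0 zW WJ).
rewrite -/W; set S := \sum_(_ <= p < _ | _) _.
set S1 := \sum_(_ <= p < _ | _) _.
(* Primes without a root carry the weight ln p / p^2, whose sum beyond z is at most ln W / z. *)
have SS : S <= S1 + ln W%:R / z%:R.
  rewrite /S (bigID (has_root_mod f)) /=; apply: lerD.
    rewrite (eq_bigr (fun p => ln p%:R / p%:R)); last first.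
      by move=> p /andP[_ hp]; rewrite /res_exp hp expn1.
    rewrite /S1 [leRHS](@big_cat_nat _ _ _ W.+1) //= ?ltnS //; last exact: ltnW.
    by rewrite lerDl; apply: sumr_ge0 => p _; rewrite divr_ge0 ?ln_nat_ge0.
  apply: le_trans (_ : \sum_(z.+1 <= p < W.+1) ln W%:R * ((p ^ 2)%:R)^-1 <= _).
    rewrite big_mkcond /= [leLHS]big_nat_cond [leRHS]big_nat_cond.
    apply: ler_sum => p /andP[/andP[zp pW] _]; case: ifP => [/andP[pp np]|_].
      rewrite /res_exp (negPf np) ler_wpM2r ?invr_ge0 // ler_ln_nat //.
      exact: prime_gt0.
    by rewrite mulr_ge0 ?ln_nat_ge0 ?invr_ge0.
  by rewrite -mulr_sumr ler_wpM2l ?ln_nat_ge0 // sum_inv_sqr_gt.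
have zR : 0 < (z%:R : R) by rewrite ltr0n.
have lz : ln z%:R / z%:R <= 1 :> R by rewrite ler_pdivrMr // mul1r ln_nat_le.
have lWz : ln W%:R / z%:R <= J.+1%:R :> R.
  rewrite ler_pdivrMr //; apply: le_trans lnW _; rewrite ler_wpM2l //; exact: ln_nat_le.
have BdR : 0 < ((B ^ d)%:R : R) by rewrite ltr0n expn_gt0 B0.
have -> : (J * (d * 2 ^ d * C0 * B ^ d))%:R = (B ^ d)%:R * A :> R.
  by rewrite /A -natrM; congr _%:R; rewrite mulnA mulnC.
rewrite -!mulrA -mulrDr ler_pM2l // => main.
have zBR : z%:R * (d%:R * (ln W%:R / B%:R)) <= d%:R * J.+1%:R :> R.
  rewrite mulrCA ler_wpM2l //; rewrite mulrCA; apply: le_trans lWz.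
  rewrite ler_wpM2l ?ln_nat_ge0 // ler_pdivrMr ?ltr0n // mulrC ler_pdivlMr //.
  by rewrite -natrM ler_nat mulnn.
have lnB : ln B%:R = 32 * d%:R ^+ 2 * ln z%:R :> R.
  by rewrite ln_natX // /Kz natrM natrX.
have AS : A * S <= A * S1 + A * J.+1%:R.
  by rewrite -mulrDr ler_wpM2l ?(ltW A0) //; apply: le_trans SS _; rewrite lerD2l.
rewrite mulrC ler_pdivrMr // [S1 * A]mulrC.
have d1 : (1 : R) <= d%:R ^+ 2 by rewrite exprn_ege1 // ler1n.
have lz0 := ln_nat_ge0 R z.
have dl : ln z%:R <= d%:R ^+ 2 * ln z%:R :> R by rewrite ler_peMl.
move: main lE; rewrite lnB /E; lra.
Qed.

Lemma ln2_ge : 1 / 2 <= ln (2%:R : R).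
Proof.
have := @le_ln1Dx R (- 2^-1) _; have -> : 1 - 2^-1 = 2^-1 :> R by lra.
rewrite lnV ?posrE // => /(_ _) h; have := h _; move/(_ ltac:(lra)); lra.
Qed.

Lemma trunc_log_ln (z : nat) : (0 < z)%N -> (trunc_log 2 z)%:R <= 2 * ln (z%:R : R).
Proof.
move=> z0; have /andP[h _] := trunc_log_bounds (isT : 1 < 2)%N z0.
have : ln (2 ^ trunc_log 2 z)%:R <= ln (z%:R : R) by rewrite ler_ln_nat ?expn_gt0.
rewrite ln_natX //; have := ln2_ge; set t := (trunc_log 2 z)%:R.
have t0 : (0 : R) <= t by [].
move: (ln 2%:R) => l l2 h1; nra.
Qed.

Definition split_primes (a b : nat) : seq nat :=
  [seq p <- index_iota a.+1 b.+1 | prime p && has_root_mod f p].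

(** The interval (z, z^K] is covered by I dyadic blocks (M, 2M]. If each had fewer than c M / ln M
    primes with a root, each would have mass at most 2c, contradicting [split_mass]. *)
Lemma split_count : exists (c : R) (K z0 : nat), 0 < c /\ forall z, (z0 <= z)%N ->
  exists M : nat, [/\ (z <= M)%N, (M <= z ^ K)%N &
    c * M%:R <= ln M%:R * (size (split_primes M (2 * M)))%:R].
Proof.
have [c0 [K [z0 [c00 mass]]]] := split_mass.
have [z1 z1P] := ln_nat_unbounded 1.
(* As I <= 3 (K + 1) ln z, a total of 2 c I is at most (6/7) c0 ln z. *)
pose c := c0 / (7 * K.+1%:R).
have c_gt0 : 0 < c by rewrite divr_gt0 // mulr_gt0.
exists c, (2 * K.+1 + 1)%N, (maxn 2 (maxn z0 z1)); split => // z.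
rewrite !geq_max => /and3P[z2 /mass mz /z1P lz].
have zp : (0 < z)%N by apply: leq_trans z2.
pose I := (K.+1 * (trunc_log 2 z).+1)%N.
have zI : (z ^ K <= 2 ^ I * z)%N.
  apply: leq_trans (_ : z ^ K.+1 <= _)%N; first by rewrite leq_pexp2l.
  apply: leq_trans (leq_pmulr _ zp); rewrite /I mulnC expnM leq_exp2r //.
  by have /andP[_ /ltnW] := trunc_log_bounds (isT : 1 < 2)%N zp.
have IR : I%:R <= 3 * K.+1%:R * ln (z%:R : R).
  rewrite /I natrM [3 * _]mulrC -mulrA ler_wpM2l // -addn1 natrD.
  by have := trunc_log_ln zp; lra.
pose good i := c * (2 ^ i * z)%:R <= ln (2 ^ i * z)%:R *
  (size (split_primes (2 ^ i * z) (2 * (2 ^ i * z))))%:R.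
have [[i iI gi]|bad] := pselect (exists2 i, (i < I)%N & good i).
  exists (2 ^ i * z)%N; split=> //; first by rewrite leq_pmull // expn_gt0.
  have : (2 ^ i <= z ^ (2 * K.+1))%N.
    apply: leq_trans (_ : 2 ^ I <= _)%N; first by rewrite leq_pexp2l // ltnW.
    rewrite /I mulnC expnM expnM leq_exp2r // expnS -mulnn leq_mul //.
    by have /andP[] := trunc_log_bounds (isT : 1 < 2)%N zp.
  by move=> h; rewrite expnD expn1 leq_mul2r h orbT.
exfalso.
have block i : (i < I)%N ->
    \sum_((2 ^ i * z).+1 <= p < (2 ^ i.+1 * z).+1 | prime p && has_root_mod f p)
      ln p%:R / p%:R <= 2 * c.
  move=> iI; rewrite expnS -mulnA; set M := (2 ^ i * z)%N.
  have M0 : (0 < M)%N by rewrite muln_gt0 expn_gt0.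
  have M2 : (2 <= M)%N by apply: leq_trans z2 _; rewrite leq_pmull // expn_gt0.
  have MR : 0 < (M%:R : R) by rewrite ltr0n.
  have : c * M%:R > ln M%:R * (size (split_primes M (2 * M)))%:R.
    by rewrite ltNge; apply/negP => gi; apply: bad; exists i.
  rewrite -ltr_pdivrMr // => /ltW h.
  apply: le_trans (_ : 2 * (ln M%:R * (size (split_primes M (2 * M)))%:R / M%:R) <= _); last first.
    by rewrite ler_wpM2l.
  rewrite -big_filter -/(split_primes M (2 * M)).
  (* Since M < p <= 2M <= M^2, each term is at most 2 ln M / M. *)
  apply: le_trans (_ : \sum_(p <- split_primes M (2 * M)) 2 * (ln M%:R / M%:R) <= _); last first.
    by rewrite big_const_seq count_predT iter_addr_0 -mulr_natr; lra.
  rewrite big_seq [leRHS]big_seq; apply: ler_sum => p.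
  rewrite mem_filter mem_index_iota ltnS => /andP[/andP[pp _] /andP[Mp pM]].
  have p0 := prime_gt0 pp; rewrite mulrA; apply: ler_pM.
  - exact: ln_nat_ge0.
  - by rewrite invr_ge0.
  - have -> : 2 * ln M%:R = ln M%:R + ln M%:R :> R by ring.
    rewrite -ln_natM // ler_ln_nat // (leq_trans pM) // leq_mul2r M2 orbT //.
  by rewrite lef_pV2 ?posrE ?ltr0n // ler_nat ltnW.
have total J : (J <= I)%N ->
    \sum_(z.+1 <= p < (2 ^ J * z).+1 | prime p && has_root_mod f p) ln p%:R / p%:R <= 2 * c * J%:R.
  elim: J => [|J IH] JI; first by rewrite expn0 mul1n big_geq // mulr0.
  rewrite (@big_cat_nat _ _ _ (2 ^ J * z).+1) /=; last 2 first.
  - by rewrite ltnS leq_pmull // expn_gt0.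
  - by rewrite ltnS leq_mul2r leq_pexp2l ?orbT.
  by rewrite -[J.+1 in leRHS]addn1 natrD mulrDr mulr1; apply: lerD; [apply: IH; apply: ltnW | apply: block].
have {}mz : c0 * ln z%:R <= 2 * c * I%:R.
  apply: le_trans mz _; apply: le_trans (total I (leqnn _)).
  have [zK|zK] := leqP z (z ^ K).
    rewrite [leRHS](@big_cat_nat _ _ _ (z ^ K).+1) //= lerDl.
    by apply: sumr_ge0 => p _; rewrite divr_ge0 ?ln_nat_ge0.
  rewrite big_geq; last by rewrite ltnS ltnW.
  by apply: sumr_ge0 => p _; rewrite divr_ge0 ?ln_nat_ge0.
have : c0 * ln z%:R <= 2 * c * (3 * K.+1%:R * ln z%:R).
  by apply: le_trans mz _; rewrite ler_wpM2l // mulr_ge0 // ltW.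
have K0 : 0 < (K.+1%:R : R) by [].
have -> : 2 * c * (3 * K.+1%:R * ln z%:R) = 6 / 7 * (c0 * ln z%:R).
  rewrite /c; move: (K.+1%:R) K0 => k k0; field; by rewrite gt_eqF.
have : 0 < c0 * ln (z%:R : R) by rewrite mulr_gt0 // (lt_le_trans _ lz).
by lra.
Qed.

End SplitCount.

Section Periodic.
Variable R : realFieldType.

(** * A sieve for shifted primes *)

Lemma crt_sum (a b : nat) (F G : nat -> R) : (0 < a)%N -> (0 < b)%N -> coprime a b ->
  (forall n, F n = F (n %% a)%N) -> (forall n, G n = G (n %% b)%N) ->
  \sum_(n < a * b) F n * G n = (\sum_(i < a) F i) * (\sum_(j < b) G j).
Proof.
move=> a0 b0 cop Fa Gb; rewrite big_distrlr /= pair_bigA /=.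
pose f (n : 'I_(a * b)) : 'I_a * 'I_b :=
  (Ordinal (ltn_pmod n a0), Ordinal (ltn_pmod n b0)).
have finj : injective f.
  move=> m n [E1 E2]; apply/val_inj => /=.
  have : (m = n %[mod a * b])%N.
    by apply/eqP; rewrite chinese_remainder // E1 E2 !eqxx.
  by rewrite !modn_small.
have fbij : bijective f.
  by apply: inj_card_bij => //; rewrite card_prod !card_ord.
rewrite [RHS](reindex f) /=; last by apply: onW_bij.
by apply: eq_bigr => n _; rewrite Fa Gb.
Qed.

Lemma prod_primes_gt0 (s : seq nat) : all prime s -> (0 < \prod_(p <- s) p)%N.
Proof.
by move=> /allP sp; rewrite big_seq prodn_cond_gt0 // => p /sp /prime_gt0.
Qed.

Lemma crt_sum_prod (s : seq nat) (F : nat -> nat -> R) : uniq s -> all prime s ->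
  (forall p n, p \in s -> F p n = F p (n %% p)%N) ->
  \sum_(n < \prod_(p <- s) p) \prod_(p <- s) F p n = \prod_(p <- s) \sum_(n < p) F p n.
Proof.
elim: s => [|p s IH] /=.
  by move=> *; rewrite !big_nil big_ord_recl big_ord0 addr0 big_nil.
move=> /andP[ps us] /andP[pp sp] per.
rewrite [in LHS]big_cons [RHS]big_cons -IH //; last by move=> q n qs; rewrite per // inE qs orbT.
under eq_bigr do rewrite big_cons.
have s0 := prod_primes_gt0 sp.
apply: (crt_sum (F := F p) (G := fun n => \prod_(q <- s) F q n)) => //.
- exact: prime_gt0.
- rewrite coprime_sym; elim: (s) ps sp => [|q t IHt]; first by rewrite big_nil coprime1n.
  rewrite inE negb_or /= big_cons coprimeMl => /andP[pq pt] /andP[pq' tp].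
  by rewrite IHt // andbT prime_coprime // dvdn_prime2 // eq_sym.
- by move=> n; apply: per; rewrite inE eqxx.
move=> n; rewrite [LHS]big_seq [RHS]big_seq; apply: eq_bigr => q qs.
have qs' : q \in p :: s by rewrite inE qs orbT.
by rewrite (per _ _ qs') [RHS](per _ _ qs') modn_dvdm // (big_rem q) //= dvdn_mulr.
Qed.

Lemma periodic_sum_mul (G : nat -> R) (m k : nat) : (0 < m)%N ->
  (forall n, G n = G (n %% m)%N) ->
  \sum_(0 <= n < k * m) G n = k%:R * \sum_(n < m) G n.
Proof.
move=> m0 per; elim: k => [|k IH]; first by rewrite mul0n big_geq // mul0r.
rewrite mulSnr (@big_cat_nat _ _ _ (k * m)) ?leq_addr //= IH -addn1 natrD mulrDl mul1r.
congr (_ + _); rewrite -[X in bigop.body _ (index_iota X _)]add0n big_addn addKn.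
by rewrite big_mkord; apply: eq_bigr => i _; rewrite per addnC modnMDl -per.
Qed.

Lemma periodic_sum_split (G : nat -> R) (m N : nat) : (0 < m)%N ->
  (forall n, G n = G (n %% m)%N) ->
  \sum_(n < N) G n = (N %/ m)%:R * \sum_(n < m) G n + \sum_(n < N %% m) G n.
Proof.
move=> m0 per; rewrite -(big_mkord predT G) {1}(divn_eq N m).
rewrite (@big_cat_nat _ _ _ (N %/ m * m)) ?leq_addr //= periodic_sum_mul //.
congr (_ + _); rewrite -[X in bigop.body _ (index_iota X _)]add0n big_addn addKn.
by rewrite big_mkord; apply: eq_bigr => i _; rewrite per addnC modnMDl -per.
Qed.

Lemma periodic_sum_le (G : nat -> R) (m N : nat) : (0 < m)%N ->
  (forall n, G n = G (n %% m)%N) -> (forall n, 0 <= G n) ->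
  \sum_(n < N) G n <= (N%:R / m%:R + 1) * \sum_(n < m) G n.
Proof.
move=> m0 per G0; rewrite (periodic_sum_split N m0 per) mulrDl mul1r.
apply: lerD.
  rewrite ler_wpM2r ?sumr_ge0 // ler_pdivlMr ?ltr0n // -natrM ler_nat.
  exact: leq_trunc_div.
have lr : (N %% m <= m)%N by apply/ltnW/ltn_pmod.
rewrite (big_ord_widen m G lr) [leRHS](bigID (fun i : 'I_m => (i < N %% m)%N)) /=.
by rewrite lerDl sumr_ge0.
Qed.

(** Complete periods cancel, leaving an incomplete one with fewer than m terms. *)
Lemma periodic_sum0_le (G : nat -> R) (m N : nat) (c : R) : (0 < m)%N -> 
  (forall n, G n = G (n %% m)%N) -> \sum_(n < m) G n = 0 -> (forall n, `|G n| <= c) ->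
  \sum_(n < N) G n <= m%:R * c.
Proof.
move=> m0 per s0 Gc; rewrite (periodic_sum_split N m0 per) s0 mulr0 add0r.
have c0 : 0 <= c by apply: le_trans (Gc 0%N).
apply: le_trans (_ : \sum_(n < N %% m) c <= _).
  by apply: ler_sum => i _; apply: le_trans (ler_norm _) (Gc _).
have lr : (N %% m <= m)%N by apply/ltnW/ltn_pmod.
by rewrite sumr_const card_ord -[leLHS]mulr_natl ler_wpM2r // ler_nat.
Qed.

End Periodic.

Definition sqfree (q : nat) : bool := (\prod_(p <- primes q) p)%N == q.

Section Sieve.
Variable R : realFieldType.
Variable A : pred nat.
Hypothesis A4 : forall p, A p -> (4 <= p)%N.

(* [om p] is the set of forbidden residues modulo p: 0, and also 1 if p is in A.
   [phi p] has mean 0 modulo p, mean square 1 / [wh p], and equals 1 off [om p];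
   thus the products [Phi q] over squarefree q are almost orthogonal, while
   sum_q wH q * Phi q is constant on the sifted set. *)
Definition om (p n : nat) : bool := (n %% p == 0)%N || (A p && (n %% p == 1)%N).
Definition wt (p : nat) : nat := if A p then 2 else 1.
Definition phi (p n : nat) : R := 1 - p%:R / (wt p)%:R * (om p n)%:R.
Definition wh (p : nat) : R := (wt p)%:R / (p%:R - (wt p)%:R).
Definition Phi (q n : nat) : R := \prod_(p <- primes q) phi p n.
Definition wH (q : nat) : R := \prod_(p <- primes q) wh p.

Lemma phi_mod p n : phi p n = phi p (n %% p)%N.
Proof. by rewrite /phi /om modn_mod. Qed.

Lemma wt_lt p : prime p -> (0 < wt p < p)%N.
Proof. by rewrite /wt => /prime_gt1 p1; case: ifP => // /A4; lia. Qed.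

Lemma sum_om p : prime p -> (\sum_(n < p) om p n = wt p)%N.
Proof.
move=> pp; have := A4 (p := p); case: p pp => [|[|p]] // pp hA.
rewrite big_ord_recl big_ord_recl big1 ?addn0 => [|i _]; rewrite /om /wt /= ?mod0n ?modn_small //=.
- by case: (A _).
- by rewrite andbF.
- by rewrite /bump /= !add1n !ltnS.
Qed.

Lemma phi_sum p : prime p -> \sum_(n < p) phi p n = 0.
Proof.
move=> pp; have /andP[w0 wp] := wt_lt pp.
rewrite big_split /= sumr_const card_ord sumrN -mulr_sumr -natr_sum sum_om //.
by rewrite divfK ?subrr // pnatr_eq0 -lt0n.
Qed.

(** On [A] the upper bound reads 2 / (p - 2) <= 1, that is p >= 4. *)
Lemma wh_bounds p : prime p -> 0 < wh p <= 1.
Proof.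
move=> pp; have /andP[w0 wp] := wt_lt pp.
have pw : 0 < p%:R - (wt p)%:R :> R by rewrite subr_gt0 ltr_nat.
rewrite /wh divr_gt0 ?ltr0n //= ler_pdivrMr // mul1r lerBrDr -natrD ler_nat.
by rewrite /wt; case: ifP => [/A4|_]; rewrite ?addn1 // prime_gt1.
Qed.

Lemma phi_sqr_sum p : prime p -> \sum_(n < p) phi p n * phi p n = p%:R / wh p.
Proof.
move=> pp; have /andP[w0 wp] := wt_lt pp.
have pw : 0 < p%:R - (wt p)%:R :> R by rewrite subr_gt0 ltr_nat.
have wR : 0 < (wt p)%:R :> R by rewrite ltr0n.
have E n : phi p n * phi p n = phi p n + (p%:R / (wt p)%:R * (p%:R / (wt p)%:R - 1)) * (om p n)%:R.
  by rewrite /phi; case: (om p n); rewrite ?mulr1 ?mulr0; ring.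
under eq_bigr do rewrite E.
rewrite big_split /= phi_sum // add0r.
rewrite -mulr_sumr -natr_sum sum_om // /wh; field.
by rewrite !gt_eqF.
Qed.

Lemma phi_abs p n : prime p -> `|phi p n| <= p%:R.
Proof.
move=> pp; have /andP[w0 wp] := wt_lt pp.
have wR : 1 <= (wt p)%:R :> R by rewrite ler1n.
have p1 : 1 <= p%:R :> R by rewrite ler1n prime_gt0.
rewrite /phi; case: (om p n); rewrite ?mulr1 ?mulr0 ?subr0 ?normr1 //.
have x0 : 0 <= p%:R / (wt p)%:R :> R by rewrite divr_ge0.
have x1 : p%:R / (wt p)%:R <= p%:R :> R by rewrite ler_pdivrMr ?ler_peMr // (lt_le_trans ltr01).
by rewrite ler_norml; apply/andP; split; lra.
Qed.

Lemma wH_bounds q : 0 < wH q <= 1.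
Proof.
rewrite /wH; have : all prime (primes q) by apply: all_prime_primes.
elim: (primes q) => [|p s IH] /=; first by rewrite big_nil ltr01 lexx.
move=> /andP[/wh_bounds/andP[h0 h1] /IH/andP[i0 i1]]; rewrite big_cons mulr_gt0 //=.
by apply: mulr_ile1 => //; apply: ltW.
Qed.

Lemma Phi_abs q n : sqfree q -> `|Phi q n| <= q%:R.
Proof.
move=> /eqP qE; rewrite -{2}qE /Phi normr_prod natr_prod.
rewrite big_seq [leRHS]big_seq; apply: ler_prod => p; rewrite mem_primes => /and3P[pp _ _].
by rewrite normr_ge0 phi_abs.
Qed.

Lemma Phi_mod q m n : (forall p, p \in primes q -> (p %| m)%N) -> Phi q n = Phi q (n %% m)%N.
Proof.
move=> dv; rewrite /Phi big_seq [RHS]big_seq; apply: eq_bigr => p pq.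
by rewrite phi_mod [RHS]phi_mod modn_dvdm // dv.
Qed.

(** The sum over the period m = lcm(q, q') factors over the primes of m. If q = q' it is the product
    of the p / wh p. Otherwise some prime divides only one of q and q', its factor is the zero sum
    of [phi], and only an incomplete period of length at most q q' remains. *)
Lemma Phi_orth q q' N : sqfree q -> sqfree q' -> (0 < q)%N -> (0 < q')%N ->
  \sum_(n < N) Phi q n * Phi q' n <=
    if q == q' then (N%:R / q%:R + 1) * (q%:R / wH q) else (q%:R * q'%:R) ^+ 2.
Proof.
move=> sq sq' q0 q0'.
pose s := undup (primes q ++ primes q').
have us : uniq s by apply: undup_uniq.
have sp : all prime s.
  by apply/allP => p; rewrite mem_undup mem_cat !mem_primes => /orP[] /and3P[].
have sub1 : [seq p <- s | p \in primes q] =i primes q.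
  by move=> p; rewrite mem_filter mem_undup mem_cat; case: (p \in primes q).
have sub2 : [seq p <- s | p \in primes q'] =i primes q'.
  by move=> p; rewrite mem_filter mem_undup mem_cat orbC; case: (p \in primes q').
have perm1 : perm_eq [seq p <- s | p \in primes q] (primes q).
  by apply: uniq_perm; rewrite ?filter_uniq ?primes_uniq.
have perm2 : perm_eq [seq p <- s | p \in primes q'] (primes q').
  by apply: uniq_perm; rewrite ?filter_uniq ?primes_uniq.
pose F p n : R := (if p \in primes q then phi p n else 1) * (if p \in primes q' then phi p n else 1).
have FE n : \prod_(p <- s) F p n = Phi q n * Phi q' n.
  rewrite big_split /= /Phi -(perm_big _ perm1) -(perm_big _ perm2) /= !big_filter.
  by rewrite [in RHS]big_mkcond [X in _ = _ * X]big_mkcond.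
have per p n : p \in s -> F p n = F p (n %% p)%N.
  by move=> _; rewrite /F phi_mod.
pose m := (\prod_(p <- s) p)%N.
have m0 : (0 < m)%N by apply: prod_primes_gt0.
have dvm p : p \in s -> (p %| m)%N by move=> ps; rewrite /m (big_rem p) //= dvdn_mulr.
have dv1 p : p \in primes q -> (p %| m)%N.
  by move=> pq; apply: dvm; rewrite mem_undup mem_cat pq.
have dv2 p : p \in primes q' -> (p %| m)%N.
  by move=> pq; apply: dvm; rewrite mem_undup mem_cat pq orbT.
have perG n : Phi q n * Phi q' n = Phi q (n %% m)%N * Phi q' (n %% m)%N.
  by rewrite (Phi_mod n dv1) (Phi_mod n dv2).
have sumE : \sum_(n < m) Phi q n * Phi q' n = \prod_(p <- s) \sum_(n < p) F p n.
  by rewrite -(crt_sum_prod us sp per); apply: eq_bigr => n _; rewrite FE.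
case: eqVneq => [qq|nqq].
  have sE : perm_eq s (primes q).
    by apply: uniq_perm; rewrite ?primes_uniq // => p; rewrite mem_undup mem_cat -qq orbb.
  have mq : m = q by rewrite /m (perm_big _ sE) /=; apply/eqP.
  have := @periodic_sum_le R _ m N m0 perG; rewrite sumE mq => H.
  have {}H := H _; apply: le_trans (H _) _; first by move=> n; rewrite -qq -expr2 sqr_ge0.
  rewrite le_eqVlt; apply/orP; left; apply/eqP; congr (_ * _).
  have -> : q%:R / wH q = \prod_(p <- primes q) (p%:R / wh p).
    by rewrite prodf_div -natr_prod (eqP sq).
  rewrite (perm_big _ sE) /= big_seq [RHS]big_seq.
  apply: eq_bigr => p pq; rewrite -phi_sqr_sum; last by move: pq; rewrite mem_primes => /andP[].
  by apply: eq_bigr => n _; rewrite /F -qq pq.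
have mle : (m <= q * q')%N.
  have -> : (q * q' = (\prod_(p <- primes q) p) * \prod_(p <- primes q') p)%N.
    by rewrite (eqP sq) (eqP sq').
  rewrite -(perm_big _ perm1) -(perm_big _ perm2) /=.
  rewrite !big_filter big_mkcond [X in (_ <= _ * X)%N]big_mkcond -big_split /= /m.
  rewrite big_seq [X in (_ <= X)%N]big_seq; apply: leq_prod => p ps.
  have p0 : (0 < p)%N by apply: prime_gt0; apply: (allP sp).
  move: ps; rewrite mem_undup mem_cat => /orP[] ->; case: ifP => //; rewrite ?muln1 ?mul1n //.
    by rewrite leq_pmulr.
  by rewrite leq_pmulr.
have s0 : \sum_(n < m) Phi q n * Phi q' n = 0.
  rewrite sumE; have [p ps px] : exists2 p, p \in s & (p \in primes q) != (p \in primes q').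
    apply/hasP/negPn/negP => /hasPn none; case/negP: nqq.
    rewrite -(eqP sq) -(eqP sq'); apply/eqP/perm_big/uniq_perm; rewrite ?primes_uniq // => p.
    have [ps|] := boolP (p \in s); first by have /negPn/eqP := none p ps.
    by rewrite mem_undup mem_cat negb_or => /andP[/negPf -> /negPf ->].
  rewrite (big_rem p) //= (_ : \sum_(n < p) F p n = 0) ?mul0r //.
  rewrite -[RHS](phi_sum (p := p)); last exact: (allP sp).
  apply: eq_bigr => n _; rewrite /F; move: px.
  by case: (p \in primes q); case: (p \in primes q') => //; rewrite ?mulr1 ?mul1r.
apply: le_trans (periodic_sum0_le N m0 perG s0 (c := q%:R * q'%:R) _) _.
  by move=> n; rewrite normrM ler_pM // Phi_abs.
by rewrite expr2 ler_wpM2r ?mulr_ge0 // -natrM ler_nat.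
Qed.

(** The combination S of the [Phi q] with weights [wH q] equals V on [T], so #|T| V^2 is at most the
    sum of S^2. There the diagonal gives at most (N + D) V, and the at most D^2 other pairs at most
    D^4 each; divide by V >= 1. *)
Lemma sieve_bound (D N : nat) (T : {pred 'I_N}) : (0 < D)%N ->
  (forall n p, n \in T -> prime p -> (p <= D)%N -> ~~ om p n) ->
  #|T|%:R * (\sum_(1 <= q < D.+1 | sqfree q) wH q) <= (N + D + D ^ 6)%:R.
Proof.
move=> D0 surv; set V := \sum_(_ <= q < _ | _) _.
have V1 : 1 <= V.
  rewrite /V big_ltn_cond // /sqfree /= big_nil eqxx /wH /= big_nil lerDl.
  by apply: sumr_ge0 => q _; have /andP[/ltW] := wH_bounds q.
have PhiT n q : n \in T -> (q <= D)%N -> (0 < q)%N -> Phi q n = 1.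
  move=> nT qD q0; rewrite /Phi big_seq big1 // => p; rewrite mem_primes => /and3P[pp _ pq].
  by rewrite /phi (negPf (surv n p nT pp _)) ?mulr0 ?subr0 // (leq_trans _ qD) // dvdn_leq.
pose S (n : nat) := \sum_(1 <= q < D.+1 | sqfree q) wH q * Phi q n.
have ST n : n \in T -> S n = V.
  move=> nT; rewrite /S /V big_nat_cond [RHS]big_nat_cond.
  by apply: eq_bigr => q /andP[/andP[q0 qD] _]; rewrite PhiT // mulr1.
have lower : #|T|%:R * V ^+ 2 <= \sum_(n < N) S n ^+ 2.
  rewrite (bigID (mem T)) /= -[leLHS]addr0; apply: lerD; last by apply: sumr_ge0 => *; apply: sqr_ge0.
  by rewrite mulr_natl -sumr_const; apply: ler_sum => n nT; rewrite ST.
have upper : \sum_(n < N) S n ^+ 2 <= (N + D)%:R * V + (D ^ 6)%:R.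
  have -> : \sum_(n < N) S n ^+ 2 = \sum_(1 <= q < D.+1 | sqfree q)
     \sum_(1 <= q' < D.+1 | sqfree q') wH q * wH q' * \sum_(n < N) Phi q n * Phi q' n.
    rewrite (eq_bigr (fun n : 'I_N => \sum_(1 <= q < D.+1 | sqfree q)
       \sum_(1 <= q' < D.+1 | sqfree q') wH q * wH q' * (Phi q n * Phi q' n))); last first.
      move=> n _; rewrite expr2 /S big_distrlr /=; apply: eq_bigr => q _.
      by apply: eq_bigr => q' _; ring.
    rewrite exchange_big /=; apply: eq_bigr => q _; rewrite exchange_big /=.
    by apply: eq_bigr => q' _; rewrite mulr_sumr.
  have -> : (N + D)%:R * V + (D ^ 6)%:R = \sum_(1 <= q < D.+1 | sqfree q) (N + D)%:R * wH q +
     \sum_(1 <= q < D.+1) \sum_(1 <= q' < D.+1) (D ^ 4)%:R.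
    rewrite -mulr_sumr; congr (_ + _); rewrite !big_const_nat !iter_addr_0 subn1 /=.
    by rewrite -!mulrnA; congr (_ *+ _); rewrite !expnS expn0; ring.
  rewrite big_mkcond [X in _ <= X + _]big_mkcond -big_split /=.
  rewrite big_nat_cond [leRHS]big_nat_cond; apply: ler_sum => q /andP[/andP[q0 qD] _].
  have D4 : \sum_(1 <= q' < D.+1) (D ^ 4)%:R >= 0 :> R by apply: sumr_ge0.
  case: ifP => sq; last by rewrite add0r.
  (* The diagonal bound is spread as a sum supported at q' = q, so that both inner sums compare term
     by term. *)
  have -> : (N + D)%:R * wH q = \sum_(1 <= q' < D.+1 | q' == q) (N + D)%:R * wH q.
    by rewrite big_nat1_eq q0 qD.
  rewrite [X in _ <= X + _]big_mkcond -big_split /= big_mkcond /=.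
  rewrite big_nat_cond [leRHS]big_nat_cond; apply: ler_sum => q' /andP[/andP[q0' qD'] _].
  have /andP[h0 h1] := wH_bounds q; have /andP[h0' h1'] := wH_bounds q'.
  have rhs0 : 0 <= (if q' == q then (N + D)%:R * wH q else 0) :> R.
    by case: ifP => // _; rewrite mulr_ge0 // ltW.
  case: ifP => sq'; last by rewrite addr_ge0.
  have := Phi_orth N sq sq' q0 q0'; rewrite [q' == q]eq_sym.
  have qR : 0 < q%:R :> R by rewrite ltr0n.
  have [<-|nqq] := eqVneq q q' => H.
    rewrite -[leLHS]addr0 lerD //.
    apply: le_trans (ler_wpM2l _ H) _; first by rewrite mulr_ge0 // ltW.
    have -> : wH q * wH q * ((N%:R / q%:R + 1) * (q%:R / wH q)) = (N%:R + q%:R) * wH q.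
      by field; rewrite !gt_eqF.
    by rewrite -natrD ler_pM2r // ler_nat leq_add2l.
  rewrite add0r; apply: le_trans (ler_wpM2l _ H) _; first by rewrite mulr_ge0 // ltW.
  have hh : wH q * wH q' <= 1 by apply: mulr_ile1 => //; apply: ltW.
  apply: le_trans (ler_piMl _ hh) _; first exact: sqr_ge0.
  rewrite -natrM -natrX ler_nat -[4%N]/(2 * 2)%N expnM leq_exp2r //.
  by rewrite -mulnn leq_mul.
have Vp : 0 < V by apply: lt_le_trans V1.
rewrite -(ler_pM2r Vp) -mulrA -expr2; apply: le_trans lower _; apply: le_trans upper _.
by rewrite [(N + D + D ^ 6)%:R]natrD mulrDl lerD2l ler_peMr.
Qed.

End Sieve.

Lemma sqfreePn (s : nat) : (0 < s)%N -> ~~ sqfree s ->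
  exists2 k, prime k & (k ^ 2 %| s)%N.
Proof.
move=> s0 ns; have [/hasP[p ps ps2]|/hasPn no] := boolP (has (fun p => (1 < logn p s)%N) (primes s)).
  exists p; first by move: ps; rewrite mem_primes => /andP[].
  by rewrite pfactor_dvdn //; move: ps; rewrite mem_primes => /andP[].
case/negP: ns; rewrite /sqfree; apply/eqP; rewrite [RHS]prod_prime_decomp //.
rewrite prime_decompE big_map /= big_seq [RHS]big_seq; apply: eq_bigr => p ps.
have := no p ps; rewrite -leqNgt => h.
have : (0 < logn p s)%N by rewrite logn_gt0.
by move: h; case: (logn p s) => [|[|]].
Qed.

Lemma sqfreeM (l s : nat) : prime l -> (0 < s)%N -> sqfree s -> ~~ (l %| s)%N -> sqfree (l * s).
Proof.
move=> pl s0 /eqP sE ls; rewrite /sqfree -{2}sE.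
have : perm_eq (primes (l * s)) (l :: primes s).
  apply: uniq_perm; rewrite ?primes_uniq //=.
    by rewrite primes_uniq mem_primes s0 (negPf ls) !andbF.
  by move=> p; rewrite (primesM _ (prime_gt0 pl) s0) (primes_prime pl) !inE.
by move=> pE; rewrite (perm_big _ pE) big_cons.
Qed.

(** * Harmonic sums over squarefree integers *)

Section HarmonicSums.
Variable R : realType.

Lemma ler_sum_inj (I J : eqType) (s : seq I) (t : seq J) (g : I -> J) (F : I -> R) (G : J -> R) :
  uniq s -> uniq t -> {in s &, injective g} -> {in s, forall x, g x \in t} ->
  {in s, forall x, F x <= G (g x)} -> {in t, forall y, 0 <= G y} ->
  \sum_(x <- s) F x <= \sum_(y <- t) G y.
Proof.
move=> us ut ginj gt FG G0.
apply: le_trans (_ : \sum_(x <- s) G (g x) <= _).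
  by rewrite big_seq [leRHS]big_seq; apply: ler_sum.
rewrite -(big_map g predT) [leRHS](bigID (fun y => y \in map g s)) /= -[leLHS]addr0.
apply: lerD; last by rewrite big_seq_cond; apply: sumr_ge0 => y /andP[yt _]; apply: G0.
rewrite -[in leRHS]big_filter le_eqVlt; apply/orP; left; apply/eqP/perm_big.
apply: uniq_perm; rewrite ?filter_uniq ?map_inj_in_uniq // => y.
rewrite mem_filter; case: (boolP (y \in map g s)) => // /mapP[x xs ->]; by rewrite gt.
Qed.

Definition harmonic_sum (Z : nat) : R := \sum_(1 <= s < Z.+1) s%:R^-1.

Lemma ln_le_harmonic Z : ln Z%:R <= harmonic_sum Z.
Proof.
suff h : ln Z.+1%:R <= harmonic_sum Z.
  case: Z h => [|Z] h; first by rewrite ln0 // /harmonic_sum big_geq.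
  by apply: le_trans h; rewrite ler_ln_nat.
elim: Z => [|Z IH]; first by rewrite ln1 /harmonic_sum big_geq.
rewrite /harmonic_sum big_nat_recr //=; apply: le_trans (lerD IH (lexx _)).
rewrite -lerBlDl -ln_div ?posrE ?ltr0n //.
have -> : Z.+2%:R / Z.+1%:R = 1 + Z.+1%:R^-1 :> R.
  by rewrite -[Z.+2]addn1 natrD mulrDl mul1r divff ?pnatr_eq0.
by apply: le_ln1Dx; apply: lt_trans (_ : 0 < _); rewrite ?invr_gt0 ?ltr0n // oppr_lt0.
Qed.

Lemma sum_inv_multiples (m Z : nat) : (0 < m)%N ->
  \sum_(1 <= s < Z.+1 | (m %| s)%N) s%:R^-1 <= m%:R^-1 * harmonic_sum Z :> R.
Proof.
move=> m0; rewrite /harmonic_sum mulr_sumr -big_filter.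
apply: (ler_sum_inj (g := fun s => (s %/ m)%N)); rewrite ?filter_uniq ?iota_uniq //.
- move=> s t; rewrite !mem_filter => /andP[ms _] /andP[mt _] E.
  by rewrite -(divnK ms) -(divnK mt) E.
- move=> s; rewrite mem_filter !mem_index_iota => /and3P[ms s0 sZ].
  rewrite divn_gt0 // dvdn_leq //=; exact: leq_ltn_trans (leq_div _ _) sZ.
- move=> s; rewrite mem_filter mem_index_iota => /and3P[ms s0 sZ].
  by rewrite -invfM -natrM mulnC divnK.
by move=> s _; rewrite mulr_ge0 ?invr_ge0.
Qed.

(** From the harmonic sum, multiples of l remove at most 1/8 and multiples of the k^2, k >= 2, at
    most 1/4 + 1/2; there remains 1/8. *)
Lemma sqfree_coprime_sum (l Z : nat) : (8 <= l)%N ->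
  harmonic_sum Z / 8 <= \sum_(1 <= s < Z.+1 | sqfree s && ~~ (l %| s)%N) s%:R^-1.
Proof.
move=> l8; have H0 : 0 <= harmonic_sum Z by apply: sumr_ge0 => s _; rewrite invr_ge0.
pose K := \sum_(2 <= k < Z.+1) \sum_(1 <= s < Z.+1 | (k ^ 2 %| s)%N) s%:R^-1 : R.
pose M := \sum_(1 <= s < Z.+1 | (l %| s)%N) s%:R^-1 : R.
have hM : M <= harmonic_sum Z / 8.
  apply: le_trans (sum_inv_multiples _ _) _; first exact: leq_trans l8.
  rewrite mulrC ler_wpM2l // lef_pV2 ?posrE ?ltr0n ?ler_nat //; exact: leq_trans l8.
have hK : K <= harmonic_sum Z * (3 / 4).
  apply: le_trans (_ : \sum_(2 <= k < Z.+1) ((k ^ 2)%:R)^-1 * harmonic_sum Z <= _).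
    rewrite [leLHS]big_nat_cond [leRHS]big_nat_cond; apply: ler_sum => k /andP[/andP[k2 _] _].
    by apply: sum_inv_multiples; rewrite expn_gt0 (leq_trans _ k2).
  rewrite -mulr_suml mulrC ler_wpM2l //.
  have [Z2|Z2] := leqP Z 1; first by rewrite big_geq ?divr_ge0.
  rewrite big_ltn //; have := @sum_inv_sqr_gt R 2 Z.+1 isT.
  rewrite -[(2 ^ 2)%N]/4%N; move: (\sum_(_ <= _ < _) _) => x; lra.
suff : harmonic_sum Z <= \sum_(1 <= s < Z.+1 | sqfree s && ~~ (l %| s)%N) s%:R^-1 + K + M.
  lra.
rewrite /K (exchange_big_dep predT) //= [X in X + _ + _]big_mkcond -!big_split /= [M]big_mkcond -big_split /=.
rewrite /harmonic_sum [leLHS]big_nat_cond [leRHS]big_nat_cond; apply: ler_sum => s /andP[/andP[s0 sZ] _].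
have s1 : 0 <= s%:R^-1 :> R by rewrite invr_ge0.
have S0 : 0 <= \sum_(2 <= i < Z.+1 | (i ^ 2 %| s)%N) s%:R^-1 :> R by apply: sumr_ge0.
have [ls|nls] /= := boolP (l %| s)%N; first by rewrite andbF add0r lerDr.
rewrite addr0 andbT; case: ifPn => [sq|]; first by rewrite lerDl.
move=> /(sqfreePn s0)[k kp ks]; rewrite add0r -big_filter.
have k2 := prime_gt1 kp.
have kin : k \in [seq i <- index_iota 2 Z.+1 | (i ^ 2 %| s)%N].
  rewrite mem_filter ks mem_index_iota k2 ltnS -ltnS (leq_trans _ sZ) // ltnS.
  apply: leq_trans (dvdn_leq s0 ks); rewrite -mulnn leq_pmulr // ltnW //.
by rewrite (big_rem k) //= lerDl sumr_ge0.
Qed.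

End HarmonicSums.

(** * The sieve density and sums over smooth numbers *)

Section SieveDensity.
Variable R : realType.
Local Notation harm := (harmonic_sum R).

Lemma wH_ge (A : pred nat) q : (forall p, A p -> (4 <= p)%N) -> (0 < q)%N -> sqfree q ->
  (count A (primes q))%:R / q%:R <= wH R A q.
Proof.
move=> A4 q0 /eqP qE; have pq : all prime (primes q) by apply: all_prime_primes.
have -> : q%:R = \prod_(p <- primes q) p%:R :> R by rewrite -natr_prod qE.
suff : (count A (primes q)).+1%:R / \prod_(p <- primes q) p%:R <= wH R A q.
  apply: le_trans; rewrite ler_wpM2r ?ler_nat // invr_ge0.
  by apply: prodr_ge0 => p _.
rewrite /wH; elim: (primes q) pq => [|p s IH] /=; first by rewrite !big_nil divr1.
move=> /andP[pp /IH {}IH]; rewrite !big_cons invfM.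
have s0 : 0 <= \prod_(j <- s) j%:R :> R by apply: prodr_ge0.
have p0 : 0 < p%:R :> R by rewrite ltr0n prime_gt0.
have /andP[w0 wp] := @wt_lt A A4 p pp.
have whp : (wt A p)%:R / p%:R <= wh R A p.
  rewrite /wh ler_wpM2l // lef_pV2 ?posrE ?subr_gt0 ?ltr_nat //.
  by rewrite gerBl.
apply: le_trans (_ : ((wt A p)%:R / p%:R) * ((count A s).+1%:R / \prod_(p <- s) p%:R) <= _); last first.
  apply: ler_pM => //; first by rewrite divr_ge0.
  by rewrite divr_ge0.
rewrite mulrACA ler_wpM2r ?mulr_ge0 ?invr_ge0 ?(ltW p0) //.
by rewrite -natrM ler_nat /wt; case: (A p) => /=; lia.
Qed.

Definition prime_range (Y Z p : nat) : bool := prime p && (Y < p <= Z)%N.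

(** By [wH_ge], q counts 1/q for each l in the range dividing it. After exchanging sums, keep for
    each l only q = l s with s <= Z squarefree and prime to l. *)
Lemma sieve_density_ge (Y Z : nat) : (8 <= Y)%N ->
  (\sum_(1 <= l < Z.+1 | prime_range Y Z l) l%:R^-1) * (harm Z / 8) <=
  \sum_(1 <= q < (Z * Z).+1 | sqfree q) wH R (prime_range Y Z) q.
Proof.
move=> Y8; set A := prime_range Y Z.
have A4 p : A p -> (4 <= p)%N.
  by move=> /and3P[_ Yp _]; apply: leq_trans (ltnW Yp); apply: leq_trans Y8.
apply: le_trans (_ : \sum_(1 <= q < (Z * Z).+1 | sqfree q) \sum_(1 <= l < Z.+1 | A l && (l %| q)%N) q%:R^-1 <= _); last first.
  rewrite [leLHS]big_nat_cond [leRHS]big_nat_cond; apply: ler_sum => q /andP[/andP[q0 qZ] sq].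
  apply: le_trans (wH_ge A4 q0 sq); rewrite -[leLHS]big_filter big_const_seq count_predT iter_addr_0.
  rewrite -[leLHS]mulr_natl ler_wpM2r ?invr_ge0 // ler_nat -size_filter uniq_leq_size ?filter_uniq ?iota_uniq //.
  move=> l; rewrite !mem_filter => /andP[/andP[Al lq] _]; rewrite Al mem_primes q0 lq.
  by case/andP: Al => ->.
rewrite (exchange_big_dep A) /=; last by move=> q l _ /andP[].
rewrite mulr_suml; apply: ler_sum => l Al.
have l8 : (8 <= l)%N by case/and3P: Al => _ Yl _; apply: leq_trans (ltnW Yl).
have pl : prime l by case/andP: Al.
have lZ : (l <= Z)%N by case/and3P: Al.
apply: le_trans (ler_wpM2l _ (sqfree_coprime_sum R Z l8)) _; first by rewrite invr_ge0.
rewrite mulr_sumr -[leLHS]big_filter -[leRHS]big_filter.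
apply: (ler_sum_inj (g := fun s => (l * s)%N)); rewrite ?filter_uniq ?iota_uniq //.
- by move=> s t _ _ /eqP; rewrite eqn_pmul2l ?prime_gt0 // => /eqP.
- move=> s; rewrite !mem_filter !mem_index_iota => /andP[/andP[ss ls] /andP[s0 sZ]].
  by rewrite sqfreeM // dvdn_mulr // muln_gt0 prime_gt0 // s0 Al ltnS leq_mul.
- by move=> s _; rewrite natrM invfM.
by move=> s _; rewrite invr_ge0.
Qed.

(** A truncation of the Euler product of (1 - 1/p)^-1 over the primes p <= k. *)
Definition smooth_sum (Z k : nat) : R :=
  \sum_(1 <= s < Z.+1 | all (leq^~ k) (primes s)) s%:R^-1.

Lemma smooth_sum_ge0 Z k : 0 <= smooth_sum Z k.
Proof. by apply: sumr_ge0 => s _; rewrite invr_ge0. Qed.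

Lemma smooth_sum1 Z : smooth_sum Z 1 <= 1.
Proof.
rewrite /smooth_sum; have [->|Z0] := posnP Z; first by rewrite big_geq.
rewrite big_ltn_cond //= big_nat_cond big1 ?addr0 ?invr1 // => s /andP[/andP[s1 _] /allP h].
have := h (pdiv s); rewrite mem_primes pdiv_prime // pdiv_dvd (ltnW s1) /= => /(_ isT).
by rewrite leqNgt prime_gt1 // pdiv_prime.
Qed.

Lemma smooth_sum_nprime Z k : ~~ prime k.+1 -> smooth_sum Z k.+1 = smooth_sum Z k.
Proof.
move=> np; apply: eq_bigl => s; apply: eq_in_all => p; rewrite mem_primes => /andP[pp _].
by rewrite leq_eqVlt ltnS; case: eqP => // pE; rewrite -pE pp in np.
Qed.

(** The terms divisible by p = k + 1 are at most 1/p times the whole sum, so admitting p costs at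
    most the Euler factor (1 - 1/p)^-1 = (k + 1) / k. *)
Lemma smooth_sum_prime Z k : prime k.+1 ->
  smooth_sum Z k.+1 * k%:R <= smooth_sum Z k * k.+1%:R.
Proof.
move=> pp; suff h : smooth_sum Z k.+1 <= smooth_sum Z k + k.+1%:R^-1 * smooth_sum Z k.+1.
  have p0 : 0 < k.+1%:R :> R by [].
  have := ler_wpM2r (ltW p0) h; rewrite mulrDl mulrAC mulVf ?gt_eqF // mul1r.
  by rewrite -{2}addn1 natrD mulrDr mulr1 lerD2r.
rewrite {1}/smooth_sum (bigID (fun s => (k.+1 %| s)%N)) /= addrC; apply: lerD.
  rewrite big_mkcond [leRHS]big_mkcond [leLHS]big_nat_cond [leRHS]big_nat_cond /=.
  apply: ler_sum => s /andP[/andP[s0 _] _]; case: ifPn => [/andP[/allP sm nd]|_]; last first.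
    by case: ifP => //; rewrite invr_ge0.
  suff -> : all (leq^~ k) (primes s) by [].
  apply/allP => p ps; have := sm p ps; rewrite leq_eqVlt => /orP[/eqP pE|]; last by [].
  by move: ps nd; rewrite mem_primes pE => /and3P[_ _ ->].
rewrite mulr_sumr -[leLHS]big_filter -[leRHS]big_filter.
apply: (ler_sum_inj (g := fun s => (s %/ k.+1)%N)); rewrite ?filter_uniq ?iota_uniq //.
- move=> s t; rewrite !mem_filter => /andP[/andP[_ ms] _] /andP[/andP[_ mt] _] E.
  by rewrite -(divnK ms) -(divnK mt) E.
- move=> s; rewrite !mem_filter !mem_index_iota => /andP[/andP[/allP sm ms] /andP[s0 sZ]].
  have d0 : (0 < s %/ k.+1)%N by rewrite divn_gt0 // dvdn_leq.
  rewrite d0 (leq_ltn_trans (leq_div _ _) sZ) !andbT; apply/allP => p.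
  rewrite mem_primes => /and3P[pq _ pd]; apply: sm; rewrite mem_primes pq s0 /=.
  by apply: dvdn_trans pd _; apply: dvdn_div.
- move=> s; rewrite mem_filter => /andP[/andP[_ ms] _].
  by rewrite -invfM -natrM mulnC divnK.
by move=> s _; rewrite mulr_ge0 ?invr_ge0.
Qed.

(* The Euler product up to k is at most 2 sqrt k, because the factors k/(k-1) only
   occur for k = 2 and for odd k. *)
Lemma smooth_sum_sqr_le Z k : (0 < k)%N -> smooth_sum Z k ^+ 2 <= 4 * k%:R.
Proof.
have F0 := smooth_sum_ge0 Z; have F1 := smooth_sum1 Z.
elim/ltn_ind: k => -[//|[|k]] IH _.
  by rewrite mulr1 (@le_trans _ _ 1) ?exprn_ile1 //; lra.
have [pk|npk] := boolP (prime k.+2); last first.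
  by rewrite smooth_sum_nprime //; apply: le_trans (IH k.+1 _ _) _; rewrite // ler_wpM2l // ler_nat.
case: k => [|k] in IH pk *.
  have := smooth_sum_prime Z pk; have := F0 2%N; have := F0 1%N.
  move: (smooth_sum Z 1) (smooth_sum Z 2) F1 => a b; rewrite mulr1; nra.
(* When k + 3 is an odd prime, k + 2 is even and, unless it is 2, adds no factor, so the bound at k
   + 1 carries over. With x = k + 1, the conclusion then follows from x (x + 2) <= (x + 1)^2. *)
have h : smooth_sum Z k.+2 ^+ 2 <= 4 * k.+1%:R.
  case: k => [|k] in IH pk *.
    have := smooth_sum_prime Z (isT : prime 2); have := F0 2%N; have := F0 1%N.
    move: (smooth_sum Z 1) (smooth_sum Z 2) F1 => a b; rewrite !mulr1; nra.
  rewrite smooth_sum_nprime; first exact: IH.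
  apply/negP => pk'; have /even_prime[] := pk; first by [].
  rewrite /= => odd1; have /even_prime[] := pk'; first by [].
  by rewrite /= in odd1 *; move: odd1; case: (odd k).
have := smooth_sum_prime Z pk; have := F0 k.+3; have := F0 k.+2.
move: (smooth_sum Z _) (smooth_sum Z _) h => b a; rewrite -[k.+3]addn1 -[k.+2]addn1 !natrD.
have : 1 <= k.+1%:R :> R by rewrite ler1n.
move: (k.+1%:R) => x x1 ax b0 a0 bx.
have x10 : 0 < x + 1 by lra.
rewrite -(ler_pM2r (_ : 0 < (x + 1) ^+ 2)) ?exprn_gt0 // -exprMn.
apply: le_trans (_ : (a * (x + 1 + 1)) ^+ 2 <= _).
  by rewrite ler_sqr ?nnegrE ?mulr_ge0 //; lra.
rewrite exprMn; apply: le_trans (ler_wpM2r _ ax) _; first exact: sqr_ge0.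
rewrite -subr_ge0 (_ : _ - _ = 4 * (x + 1 + 1)); first by lra.
by ring.
Qed.

(** A prime K + 1 multiplies the sum by at most 1 + 1/K, whose logarithm is at most 1/K <= 2/(K +
    1). *)
Lemma smooth_sum_ln Z Y K : (1 <= Y)%N -> (Y <= K)%N -> (0 < Z)%N ->
  ln (smooth_sum Z K) <= ln (smooth_sum Z Y) +
     2 * \sum_(Y.+1 <= l < K.+1 | prime l) l%:R^-1.
Proof.
move=> Y1 + Z0.
have F0 k : 0 < smooth_sum Z k.
  rewrite /smooth_sum big_ltn_cond //= invr1 ltr_wpDr //.
  by apply: sumr_ge0 => s _; rewrite invr_ge0.
elim: K => [|K IH]; first by move=> Y0; move: Y1; rewrite leqn0 in Y0; rewrite (eqP Y0).
rewrite leq_eqVlt => /orP[/eqP <-|YK]; first by rewrite big_geq // mulr0 addr0.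
have {}IH := IH YK; rewrite big_mkcond big_nat_recr //= -big_mkcond.
have [pK|npK] := boolP (prime K.+1); last by rewrite smooth_sum_nprime // addr0.
have K0 : (0 < K)%N by apply: leq_trans Y1 YK.
have KR : 0 < K%:R :> R by rewrite ltr0n.
have h : ln (smooth_sum Z K.+1) <= ln (smooth_sum Z K) + ln (1 + K%:R^-1).
  have Kp : 0 < 1 + K%:R^-1 :> R by rewrite addr_gt0 ?invr_gt0.
  rewrite -lnM ?posrE // ler_ln ?posrE ?mulr_gt0 //.
  have -> : 1 + K%:R^-1 = K.+1%:R / K%:R :> R.
    by rewrite -[K.+1]addn1 natrD mulrDl mul1r divff // gt_eqF.
  by rewrite mulrA ler_pdivlMr // smooth_sum_prime.
have h2 : ln (1 + K%:R^-1) <= K%:R^-1 :> R.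
  by apply: le_ln1Dx; apply: lt_trans (_ : 0 < _); rewrite ?invr_gt0 // oppr_lt0.
have h3 : K%:R^-1 <= 2 * K.+1%:R^-1 :> R.
  rewrite ler_pdivlMr // ler_pdivrMl // mulrC -natrM ler_nat; lia.
rewrite mulrDr addrA; apply: le_trans h _; apply: lerD; first exact: IH.
exact: le_trans h2 h3.
Qed.

(** At k = Z the smooth sum is the harmonic sum, at least ln Z; at k = Y it is at most 2 sqrt Y. For
    Y of order ln Z the term ln (4Y) / 2 is only about half of ln ln Z, so the sum over primes is
    still unbounded. *)
Lemma prime_inv_sum_ge (Y Z : nat) : (1 <= Y)%N -> (3 <= Z)%N ->
  ln (ln Z%:R) <= ln (4 * Y%:R) / 2 + 2 * \sum_(Y.+1 <= l < Z.+1 | prime l) l%:R^-1 :> R.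
Proof.
move=> Y1 Z3; have Z0 : (0 < Z)%N by apply: leq_trans Z3.
have hE : smooth_sum Z Z = harm Z.
  rewrite /smooth_sum /harmonic_sum big_mkcond [LHS]big_nat_cond [RHS]big_nat_cond.
  apply: eq_bigr => s /andP[/andP[s0 sZ] _]; rewrite (_ : all _ _) //.
  apply/allP => p; rewrite mem_primes => /and3P[_ _ ps].
  by apply: leq_trans (dvdn_leq s0 ps) _.
have lnZ : 0 < ln Z%:R :> R by rewrite ln_gt0 // ltr1n (leq_trans _ Z3).
have F0 k : 0 < smooth_sum Z k.
  rewrite /smooth_sum big_ltn_cond //= invr1 ltr_wpDr //.
  by apply: sumr_ge0 => s _; rewrite invr_ge0.
apply: le_trans (_ : ln (smooth_sum Z Z) <= _).
  by rewrite hE ler_ln ?posrE // ?ln_le_harmonic // (lt_le_trans lnZ) // ln_le_harmonic.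
have F4 k : (0 < k)%N -> (k <= Y)%N -> ln (smooth_sum Z k) <= ln (4 * Y%:R) / 2 :> R.
  move=> k0 kY; rewrite ler_pdivlMr // [leLHS]mulr_natr -lnXn //.
  rewrite ler_ln ?posrE ?exprn_gt0 ?mulr_gt0 ?ltr0n //.
  by apply: le_trans (smooth_sum_sqr_le Z k0) _; rewrite ler_wpM2l // ler_nat.
have [YZ|ZY] := leqP Y Z.
  by apply: le_trans (smooth_sum_ln Y1 YZ Z0) _; rewrite lerD2r F4.
by rewrite big_geq 1?leqW // mulr0 addr0 F4 // ltnW.
Qed.

End SieveDensity.

(** * Primes p sharing a large divisor of p - 1 *)

Lemma pigeonhole_seq (s : seq nat) (b : nat -> nat) (m S : nat) :
  (forall x, x \in s -> (b x < m)%N) -> (m * S < size s)%N ->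
  exists2 v, (v < m)%N & (S < size [seq x <- s | b x == v])%N.
Proof.
move=> bm hs; suff [v hv] : exists v : 'I_m, (S < size [seq x <- s | b x == v])%N.
  by exists v.
apply/existsP; apply: contraTT hs => /existsPn no; rewrite -leqNgt.
have -> : size s = (\sum_(v < m) size [seq x <- s | b x == v])%N.
  under eq_bigr do rewrite size_filter -sum1_count big_mkcond /=.
  rewrite exchange_big /= -sum1_size big_seq [RHS]big_seq; apply: eq_bigr => x xs.
  rewrite (bigD1 (Ordinal (bm x xs))) //= eqxx big1 // => v.
  by rewrite -val_eqE /= eq_sym => /negPf ->.
rewrite -[X in (_ <= X * _)%N]card_ord -sum_nat_const; apply: leq_sum => v _.
by rewrite leqNgt no.
Qed.

Lemma size_filter3 (s : seq nat) (a b : pred nat) :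
  size s = (size [seq x <- s | a x] + (size [seq x <- s | ~~ a x & ~~ b x] +
    size [seq x <- s | ~~ a x & b x]))%N.
Proof.
rewrite !size_filter; elim: s => //= x s ->.
by case: (a x); case: (b x) => /=; lia.
Qed.

Section ShiftedPrimes.
Variable R : realType.

Lemma size_leq_card (N : nat) (s : seq nat) : uniq s -> all (fun x => (x < N)%N) s ->
  (size s <= #|[pred n : 'I_N | (n : nat) \in s]|)%N.
Proof.
move=> us /allP sN; case: N sN => [|N] sN; first by case: s us sN => // x s _ /(_ x (mem_head _ _)).
rewrite cardE -(size_map (inord : nat -> 'I_N.+1) s); apply: uniq_leq_size.
  by rewrite map_inj_in_uniq // => x y /sN xN /sN yN /(congr1 val); rewrite /= !inordK.
by move=> y /mapP[x xs ->]; rewrite mem_enum inE inordK // sN.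
Qed.

(* The hypothesis Z^14 <= N makes the error term Z^12 of the sieve of level Z^2
   negligible. *)
Lemma common_codivisor (c : R) (K S : nat) : 0 < c -> exists Z0, forall Z N, (Z0 <= Z)%N ->
  (Z ^ 14 <= N)%N -> (N <= Z ^ K)%N -> forall P : seq nat,
  uniq P -> all prime P -> all (leq^~ N) P -> c * N%:R <= ln N%:R * (size P)%:R ->
  exists b (T : seq nat), [/\ size T = S, uniq T, {subset T <= P} &
     forall p, p \in T -> exists2 a, (0 < a <= Z)%N & p = (a * b).+1].
Proof.
(* [E0] makes the sieve bound for [P2] at most a quarter of c N / ln N; [Cy] is the threshold at
   which the pigeonhole count of cofactors of [P3] becomes contradictory. *)
move=> c0; pose E0 : R := 128 * K.+1%:R / c.
have E00 : 0 < E0 by rewrite divr_gt0 // mulr_gt0.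
pose Cy : R := 4 * K.+1%:R * S.+1%:R / c.
have Cy0 : 0 < Cy by rewrite divr_gt0 // !mulr_gt0.
pose C1 := Cy + 10.
have C10 : 0 < C1 by rewrite addr_gt0.
(* Ensures ln ln Z >= 4 E0 + ln (4 C1), which brings the sum of 1/l over the primes of (Y, Z] up to
   [E0]. *)
have [z1 hz1] := ln_nat_unbounded (expR (4 * E0 + ln (4 * C1)) + 1).
have [z2 hz2] : exists z2 : nat, forall z, (z2 <= z)%N -> 4 * K.+1%:R <= c * z%:R.
  exists (Num.truncn (4 * K.+1%:R / c)).+1 => z h.
  rewrite [leRHS]mulrC -ler_pdivrMr //; apply: le_trans (ltW (truncnS_gt _)) _.
  by rewrite ler_nat.
exists (maxn 3 (maxn z1 z2)) => Z N; rewrite !geq_max => /and3P[Z3 /hz1 lZ1 /hz2 cZ] ZN NZ.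
move=> P uP pP PN big.
have Z0 : (0 < Z)%N by apply: leq_trans Z3.
have N0 : (0 < N)%N by apply: leq_trans ZN; rewrite expn_gt0 Z0.
have lZ : expR (4 * E0 + ln (4 * C1)) <= ln Z%:R by apply: le_trans lZ1; rewrite lerDl.
have l1 : 1 <= ln Z%:R :> R by apply: le_trans lZ1; rewrite lerDr ltW // expR_gt0.
have l0 : 0 < ln Z%:R :> R by apply: lt_le_trans l1.
(* Just above Cy ln Z, with 8 added because [sieve_density_ge] asks for Y >= 8; the 10 in [C1]
   absorbs the rounding and this 8. *)
pose Y := ((Num.truncn (Cy * ln Z%:R)).+1 + 8)%N.
have Y8 : (8 <= Y)%N by rewrite leq_addl.
have YgeR : Cy * ln Z%:R < Y%:R.
  by apply: lt_le_trans (truncnS_gt _) _; rewrite ler_nat leq_addr.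
have YleR : Y%:R <= C1 * ln Z%:R.
  rewrite /Y -addn1 !natrD /C1 mulrDl -addrA; apply: lerD; last by lra.
  by rewrite truncn_le mulr_ge0 // ltW.
pose A := prime_range Y Z.
pose E : R := \sum_(1 <= l < Z.+1 | A l) l%:R^-1.
have EE : E = \sum_(Y.+1 <= l < Z.+1 | prime l) l%:R^-1.
  rewrite (@big_nat_widenl _ _ _ _ 1%N) // /E [LHS]big_nat_cond [RHS]big_nat_cond.
  apply: eq_bigl => l; rewrite /A /prime_range ltnS.
  by case: (prime l); case: (0 < l)%N; case: (l <= Z)%N; case: (Y < l)%N.
have hE : E0 <= E.
  have := @prime_inv_sum_ge R Y Z (leq_trans (isT : 1 <= 8)%N Y8) Z3; rewrite -EE.
  have h1 : 4 * E0 + ln (4 * C1) <= ln (ln Z%:R).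
    by rewrite -[leLHS]expRK ler_ln ?posrE ?expR_gt0.
  have h2 : ln (4 * Y%:R) <= ln (4 * C1) + ln (ln Z%:R).
    rewrite -lnM ?posrE ?mulr_gt0 // ler_ln ?posrE ?mulr_gt0 ?ltr0n //.
    by rewrite -mulrA ler_wpM2l.
  lra.
have YZ : (Y <= Z)%N.
  rewrite leqNgt; apply/negP => ZY; have := lt_le_trans E00 hE.
  by rewrite EE big_geq ?ltxx // ltnW // ltnS.
have lnN : ln N%:R <= K%:R * ln Z%:R :> R by rewrite -ln_natX // ler_ln_nat.
have lnN0 := ln_nat_ge0 R N.
pose hasA p := has (fun l => A l && (l %| p.-1)%N) (iota 1 Z).
(* [P1] holds the few primes below the sieve level, [P2] those p for which p - 1 has no prime factor
   in (Y, Z], and [P3] the rest, which must be at least half of the guaranteed count. *)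
pose P1 := [seq p <- P | (p <= Z * Z)%N].
pose P2 := [seq p <- P | ~~ (p <= Z * Z)%N & ~~ hasA p].
pose P3 := [seq p <- P | ~~ (p <= Z * Z)%N & hasA p].
have szP : size P = (size P1 + (size P2 + size P3))%N.
  exact: size_filter3.
have sz1 : (size P1 <= Z * Z)%N.
  rewrite -(size_iota 1 (Z * Z)); apply: uniq_leq_size; first by rewrite filter_uniq.
  move=> p; rewrite mem_filter mem_iota => /andP[pZ /(allP pP)/prime_gt0 p0].
  by rewrite p0 add1n ltnS.
have hV := @sieve_density_ge R Y Z Y8.
rewrite -/A -/E in hV; set V := \sum_(_ <= q < _ | _) _ in hV.
have A4 p : A p -> (4 <= p)%N.
  by move=> /and3P[_ Yp _]; apply: leq_trans (ltnW Yp); apply: leq_trans Y8.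
have sz2 : (size P2)%:R * V <= 4 * N%:R.
  pose T := [pred n : 'I_N.+1 | (n : nat) \in P2].
  have : (size P2 <= #|T|)%N.
    apply: size_leq_card; first by rewrite filter_uniq.
    by apply/allP => p; rewrite mem_filter => /andP[_ /(allP PN)].
  have V0 : 0 <= V.
    apply: sumr_ge0 => q _; by have /andP[/ltW] := @wH_bounds R A A4 q.
  rewrite -(ler_nat R) => /(ler_wpM2r V0)/le_trans; apply.
  apply: le_trans (@sieve_bound R A A4 (Z * Z) N.+1 T _ _) _.
  - by rewrite muln_gt0 Z0.
  (* A prime n > Z^2 avoids 0 modulo every prime up to Z^2; being in [P2], it also avoids 1 modulo
     the primes of [A]. *)
  - move=> n q; rewrite inE mem_filter => /andP[/andP[nZ nA] /(allP pP) pn] pq qZ.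
    rewrite -ltnNge in nZ; rewrite /om negb_or; apply/andP; split.
      rewrite -/(dvdn q n) dvdn_prime2 //; apply/negP => /eqP qn.
      by move: qZ; rewrite qn leqNgt nZ.
    apply: contra nA => /andP[Aq /eqP n1]; apply/hasP; exists q.
      have /and3P[_ Yq qZ'] := Aq.
      by rewrite mem_iota prime_gt0 // add1n ltnS.
    by rewrite Aq /= (divn_eq n q) n1 addn1 /= dvdn_mull.
  rewrite -[4]/(4%:R) -natrM ler_nat.
  have h2 : (Z * Z <= N)%N by apply: leq_trans ZN; rewrite mulnn leq_pexp2l.
  have h12 : ((Z * Z) ^ 6 <= N)%N by apply: leq_trans ZN; rewrite mulnn -expnM leq_pexp2l.
  by rewrite (_ : 4 * N = N + N + N + N)%N ?leq_add //; [rewrite -addn1 leq_add | rewrite !mulSn mul0n addn0 !addnA].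
have b2 : ln N%:R * (size P2)%:R <= c * N%:R / 4.
  have hh : ln Z%:R <= harmonic_sum R Z by apply: ln_le_harmonic.
  have hV2 : E0 * (ln Z%:R / 8) <= V.
    apply: le_trans hV; apply: ler_pM => //; first exact: ltW.
      by rewrite divr_ge0 // ltW.
    by rewrite ler_pM2r // invr_gt0.
  have s2 : (size P2)%:R * (E0 * (ln Z%:R / 8)) <= 4 * N%:R.
    by apply: le_trans sz2; rewrite ler_wpM2l.
  have e1 : E0 * c = 128 * K.+1%:R by rewrite /E0 divfK // gt_eqF.
  apply: le_trans (_ : K.+1%:R * ln Z%:R * (size P2)%:R <= _).
    rewrite ler_wpM2r //; apply: le_trans lnN _.
    by apply: ler_wpM2r; [exact: ltW | rewrite ler_nat].
  have := ler_wpM2r (ltW c0) s2; rewrite [leLHS](_ : _ = (size P2)%:R * ln Z%:R / 8 * (E0 * c)); last by ring.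
  rewrite e1; move: ((size P2)%:R) (ln Z%:R) (K.+1%:R) (N%:R) => x y z t; lra.
have b1 : ln N%:R * (size P1)%:R <= c * N%:R / 4.
  have : ln N%:R * (size P1)%:R <= K.+1%:R * Z%:R * (Z * Z)%:R :> R.
    apply: ler_pM => //; last by rewrite ler_nat.
    apply: le_trans lnN _; apply: ler_pM; rewrite ?ler_nat ?(ltW l0) //; exact: ln_nat_le.
  move/le_trans; apply.
  have ZN4 : (Z * (Z * (Z * Z)) <= N)%N.
    have -> : (Z * (Z * (Z * Z)) = Z ^ 4)%N by rewrite !expnS expn0 muln1.
    by apply: leq_trans ZN; exact: leq_pexp2l.
  rewrite ler_pdivlMr //; apply: le_trans (_ : c * (Z * (Z * (Z * Z)))%:R <= _); last first.
    by rewrite ler_pM2l // ler_nat.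
  have := ler_wpM2r (_ : 0 <= (Z * (Z * Z))%:R) cZ => /(_ (ler0n _ _)).
  rewrite !natrM; lra.
have b3 : c * N%:R / 2 <= ln N%:R * (size P3)%:R.
  move: big; rewrite szP !natrD !mulrDr; lra.
pose l p := nth 0%N [seq l <- iota 1 Z | A l && (l %| p.-1)%N] 0.
have lP p : hasA p -> [/\ A (l p), (l p %| p.-1)%N & (0 < l p <= Z)%N].
  rewrite /hasA has_filter /l => /eqP ne.
  have : nth 0%N [seq l <- iota 1 Z | A l && (l %| p.-1)%N] 0 \in [seq l <- iota 1 Z | A l && (l %| p.-1)%N].
    by case: [seq _ <- _ | _] ne => // x s _; rewrite mem_head.
  by rewrite mem_filter mem_iota => /andP[/andP[-> ->] /=]; rewrite add1n ltnS.
(* Cofactors are at most N / Y since l > Y; were each hit at most S times, [P3] would be too small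
   by the choice of [Cy]. *)
have [v _ hv] : exists2 v, (v < (N %/ Y).+1)%N & (S < size [seq p <- P3 | (p.-1 %/ l p)%N == v])%N.
  apply: pigeonhole_seq.
    move=> p; rewrite mem_filter => /andP[/andP[_ /lP[Al _ _]] pP'].
    have /and3P[_ Yl _] := Al; rewrite ltnS; apply: leq_trans (leq_div2l _ (leq_trans (isT : 0 < 8)%N Y8) (ltnW Yl)) _.
    by apply: leq_div2r; apply: leq_trans (leq_pred _) _; apply: (allP PN).
  rewrite ltnNge; apply/negP => hs.
  have Y0 : 0 < Y%:R :> R by rewrite ltr0n (leq_trans _ Y8).
  have h1 : ((N %/ Y).+1)%:R <= 2 * N%:R / Y%:R :> R.
    rewrite ler_pdivlMr // -!natrM ler_nat mulSn mul2n -addnn leq_add //; last exact: leq_trunc_div.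
    apply: leq_trans YZ _; apply: leq_trans ZN; rewrite -{1}[Z]expn1; exact: leq_pexp2l.
  have h2 : (size P3)%:R <= 2 * N%:R / Y%:R * S.+1%:R :> R.
    apply: le_trans (_ : ((N %/ Y).+1 * S)%:R <= _); first by rewrite ler_nat.
    by rewrite natrM; apply: ler_pM; rewrite ?ler_nat.
  have h3 : c * N%:R / 2 <= K.+1%:R * ln Z%:R * (2 * N%:R / Y%:R * S.+1%:R).
    apply: le_trans b3 _; apply: ler_pM => //; apply: le_trans lnN _.
    by apply: ler_wpM2r; [exact: ltW | rewrite ler_nat].
  have NR : 0 < N%:R :> R by rewrite ltr0n.
  have : c * Y%:R <= 4 * K.+1%:R * S.+1%:R * ln Z%:R.
    have := ler_wpM2r (ltW (mulr_gt0 (ltr0n R 2 : 0 < 2) Y0)) h3.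
    rewrite [leRHS](_ : _ = 4 * K.+1%:R * S.+1%:R * ln Z%:R * N%:R); last by field; rewrite gt_eqF.
    rewrite [leLHS](_ : _ = c * Y%:R * N%:R); last by field.
    by rewrite ler_pM2r.
  apply/negP; rewrite -ltNge [ltRHS]mulrC -ltr_pdivrMr //; apply: le_lt_trans YgeR.
  by rewrite /Cy le_eqVlt; apply/orP; left; apply/eqP; ring.
exists v, (take S [seq p <- P3 | (p.-1 %/ l p)%N == v]); split.
- by rewrite size_takel // ltnW.
- by rewrite take_uniq // !filter_uniq.
- by move=> p /mem_take; rewrite !mem_filter => /andP[_ /andP[]].
move=> p /mem_take; rewrite !mem_filter => /and3P[/eqP vE /andP[_ /lP[_ dv lZ']] pP'].
exists (l p) => //; rewrite -vE mulnC divnK // prednK // prime_gt0 //.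
exact: (allP pP).
Qed.

End ShiftedPrimes.

(** * A modulus with a small multiplicative group *)

Lemma nat_root (m H : nat) : (0 < m)%N -> (0 < H)%N ->
  exists2 x, (0 < x)%N & (x ^ m <= H < x.+1 ^ m)%N.
Proof.
move=> m0 H0.
have ex : exists x, (x ^ m <= H)%N by exists 1%N; rewrite exp1n.
have ub x : (x ^ m <= H)%N -> (x <= H)%N.
  move=> h; apply: leq_trans h; case: x => // x.
  by rewrite -{1}[x.+1]expn1 leq_pexp2l.
have [x hx xmax] := ex_maxnP ex ub; exists x.
  by apply: xmax; rewrite exp1n.
by rewrite hx ltnNge; apply/negP => /xmax; rewrite ltnn.
Qed.

Section SmoothModulus.
Variable R : realType.
Variables (n : nat) (C : 'M[int]_n.+1).
Hypothesis irr : irreducible_poly (map_poly intr (char_poly C) : {poly rat}).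
Local Notation f := (char_poly C).

(** Take s primes of (M, N], N = 2M, with N^s <= H < N^(s+1) and a common codivisor b. Their product
    is at least H / (N 2^s), and t <= N Z^s. Here s is bounded, M^n0 <= H and Z^n0 <= N, so both
    losses are small powers of H. *)
Lemma smooth_modulus (eps : R) (z0 : nat) : 0 < eps ->
  exists H0, forall H, (H0 <= H)%N -> exists (ps : seq nat) (t : nat),
  [/\ [/\ uniq ps, all prime ps, all (has_root_mod f) ps & all (fun p => (z0 < p)%N) ps],
      (0 < t)%N, {in ps, forall p, (p.-1 %| t)%N},
      (\prod_(p <- ps) p <= H)%N &
      ln H%:R <= ln (\prod_(p <- ps) p)%N%:R + eps * ln H%:R /\ ln t%:R <= eps * ln H%:R].
Proof.
move=> eps0; have [c [K0 [z1 [c0 count]]]] := split_count R irr.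
pose K := K0.+1.
(* 14 is required by [common_codivisor]. In 3 ln H <= eps n0 ln H, one ln H pays for n0 ln M, one
   for n0 s ln Z and one for the bounded terms. *)
have [n0 [n14 n0eps]] : exists n0, (14 <= n0)%N /\ 3 <= eps * n0%:R.
  exists (maxn 14 (Num.truncn (3 / eps)).+1); rewrite leq_maxl; split=> //.
  rewrite [leRHS]mulrC -ler_pdivrMr //; apply: le_trans (ltW (truncnS_gt _)) _.
  by rewrite ler_nat leq_maxr.
have n00 : (0 < n0)%N by apply: leq_trans n14.
pose S := (K * n0)%N.
(* The constant is c / 2 because c M = (c / 2) N; the exponent comes from N < (Z + 1)^n0 <= Z^(2
   n0). *)
have [Z0 codiv] := common_codivisor (2 * n0) S.+1 (divr_gt0 c0 (ltr0n R 2 : 0 < 2)).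
pose X := maxn 2 (maxn z0 (maxn z1 ((maxn 2 Z0).+1 ^ n0))).
have [z2 hz2] := ln_nat_unbounded (2 * S.+1%:R * n0%:R + 2 * n0%:R : R).
exists (maxn (X.+1 ^ S) z2) => H; rewrite geq_max => /andP[HX /hz2 lnH].
have S0 : (0 < S)%N by rewrite muln_gt0.
have H0 : (0 < H)%N by apply: leq_trans HX; rewrite expn_gt0.
have [x x0 /andP[xH Hx]] := nat_root S0 H0.
have Xx : (X <= x)%N.
  by rewrite -ltnS -(@ltn_exp2r _ _ S) //; apply: leq_ltn_trans (leq_trans _ HX) Hx; rewrite leq_exp2r.
move: (Xx); rewrite !geq_max => /and4P[x2 xz0 xz1 xZ].
have [M [xM MxK cM]] := count x xz1.
have M0 : (0 < M)%N by apply: leq_trans xM.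
have M2 : (2 <= M)%N by apply: leq_trans xM.
pose N := (2 * M)%N; pose P := split_primes C M N.
have N0 : (0 < N)%N by rewrite muln_gt0.
have MH : (M ^ n0 <= H)%N.
  apply: leq_trans xH; rewrite /S expnM leq_exp2r //; apply: leq_trans MxK _.
  by rewrite leq_pexp2l.
have [Z Zp /andP[ZN NZ]] := nat_root n00 N0.
have Zbig : (maxn 2 Z0 <= Z)%N.
  rewrite -ltnS -(@ltn_exp2r _ _ n0) //; apply: leq_ltn_trans _ NZ.
  apply: leq_trans (_ : (maxn 2 Z0).+1 ^ n0 <= _)%N; first by rewrite leq_exp2r.
  by apply: leq_trans xZ _; apply: leq_trans xM _; rewrite leq_pmull.
move: Zbig; rewrite geq_max => /andP[Z2 ZZ0].
have memP p : p \in P -> [/\ prime p, has_root_mod f p, (M < p)%N & (p <= N)%N].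
  by rewrite mem_filter mem_index_iota ltnS => /andP[/andP[-> ->] /andP[-> ->]].
have [b [T [szT uT sT codT]]] : exists b (T : seq nat), [/\ size T = S.+1, uniq T, {subset T <= P} &
     forall p, p \in T -> exists2 a, (0 < a <= Z)%N & p = (a * b).+1].
  apply: (codiv Z N) => //.
  - by apply: leq_trans ZN; rewrite leq_pexp2l.
  - rewrite mulnC expnM; apply: leq_trans (ltnW NZ) _; rewrite -expnM mulnC expnM.
    by rewrite leq_exp2r // -mulnn; apply: leq_trans (leq_mul Z2 (leqnn Z)); rewrite mul2n -addnn -addn1 leq_add2l.
  - by rewrite filter_uniq ?iota_uniq.
  - by apply/allP => p /memP[].
  - by apply/allP => p /memP[].
  have -> : c / 2 * N%:R = c * M%:R by rewrite natrM mulrA divfK ?pnatr_eq0.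
  apply: le_trans cM _.
  by rewrite ler_wpM2r // ler_ln_nat // leq_pmull.
pose s := trunc_log N H.
have N1 : (1 < N)%N by apply: leq_trans M2 _; rewrite leq_pmull.
have /andP[sH Hs] := trunc_log_bounds N1 H0; rewrite -/s in sH Hs.
have xN : (x.+1 <= N)%N.
  by rewrite /N mul2n -addnn -addn1 leq_add.
have sS : (s <= S)%N.
  rewrite -ltnS -(ltn_exp2l _ _ N1); apply: leq_ltn_trans sH _.
  apply: leq_trans Hx _; apply: leq_trans (_ : N ^ S <= _)%N; last by rewrite leq_pexp2l.
  by rewrite leq_exp2r.
pose ps := take s T.
have szps : size ps = s by rewrite size_takel // szT ltnW.
have psT p : p \in ps -> p \in T by move/mem_take.
have psP p : p \in ps -> [/\ prime p, has_root_mod f p, (M < p)%N & (p <= N)%N].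
  by move=> /psT/sT/memP.
have b0 : (0 < b)%N.
  have hT : nth 0%N T 0 \in T by rewrite mem_nth // szT.
  have [a _ aE] := codT _ hT; have [pp _ _ _] := memP _ (sT _ hT).
  by rewrite lt0n; apply/eqP => bz; move: pp; rewrite aE bz muln0.
have bN : (b <= N)%N.
  have hT : nth 0%N T 0 \in T by rewrite mem_nth // szT.
  have [a /andP[a0 _] aE] := codT _ hT; have [_ _ _ pN] := memP _ (sT _ hT).
  by apply: leq_trans pN; rewrite aE ltnW // ltnS leq_pmull.
have quo p : p \in ps -> [/\ (0 < p.-1 %/ b)%N, (p.-1 %/ b <= Z)%N & (b * (p.-1 %/ b))%N = p.-1].
  by move=> /psT/codT[a /andP[a0 aZ] ->] /=; rewrite mulnK // mulnC.
(* A common multiple of the p - 1 in which the large factor [b] is paid for only once. *)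
pose t := (b * \prod_(p <- ps) (p.-1 %/ b))%N.
have prod_le (F : nat -> nat) B : {in ps, forall p, F p <= B}%N -> (\prod_(p <- ps) F p <= B ^ s)%N.
  rewrite -szps; elim: (ps) => [|p q IH] h; first by rewrite big_nil expn0.
  rewrite big_cons expnS leq_mul // ?h ?mem_head // IH // => r rq; apply: h.
  by rewrite inE rq orbT.
have prod_ge (F : nat -> nat) B : {in ps, forall p, B <= F p}%N -> (B ^ s <= \prod_(p <- ps) F p)%N.
  rewrite -szps; elim: (ps) => [|p q IH] h; first by rewrite big_nil expn0.
  rewrite big_cons expnS leq_mul // ?h ?mem_head // IH // => r rq; apply: h.
  by rewrite inE rq orbT.
have n0R : 0 < n0%:R :> R by rewrite ltr0n.
have lnMH : n0%:R * ln M%:R <= ln H%:R :> R by rewrite -ln_natX // ler_ln_nat // expn_gt0 M0.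
have lnZN : n0%:R * ln Z%:R <= ln N%:R :> R by rewrite -ln_natX // ler_ln_nat // expn_gt0 Zp.
have lnsN : s%:R * ln N%:R <= ln H%:R :> R by rewrite -ln_natX // ler_ln_nat // expn_gt0 N0.
have lnHs : ln H%:R <= s.+1%:R * ln N%:R :> R by rewrite -ln_natX // ler_ln_nat // ltnW.
have lnN : ln N%:R = ln 2%:R + ln M%:R :> R by rewrite ln_natM.
have ln2 : ln 2%:R <= 2 :> R by apply: ln_nat_le.
have lnM0 := ln_nat_ge0 R M; have lnZ0 := ln_nat_ge0 R Z; have ln20 := ln_nat_ge0 R 2.
have lnH0 := ln_nat_ge0 R H.
have sR : s.+1%:R <= S.+1%:R :> R by rewrite ler_nat.
have epsH : 3 * ln H%:R <= eps * n0%:R * ln H%:R by rewrite ler_wpM2r.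
exists ps, t; split.
- split; first by rewrite take_uniq.
  + by apply/allP => p /psP[].
  + by apply/allP => p /psP[].
  + by apply/allP => p /psP[_ _ Mp _]; apply: leq_ltn_trans Mp; apply: leq_trans xM.
- rewrite muln_gt0 b0 big_seq prodn_cond_gt0 // => p /quo[] //.
- move=> p pps; have [_ _ <-] := quo p pps; rewrite /t dvdn_pmul2l //.
  by rewrite (big_rem p) //= dvdn_mulr.
- by apply: leq_trans sH; apply: prod_le => p /psP[].
split.
  have : s%:R * ln M%:R <= ln (\prod_(p <- ps) p)%N%:R :> R.
    rewrite -ln_natX // ler_ln_nat ?expn_gt0 ?M0 //.
    by apply: prod_ge => p /psP[_ _ /ltnW].
  move=> hm; rewrite -lerBlDl; apply: le_trans (lerB lnHs hm) _.
  rewrite lnN -(ler_pM2r n0R).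
  have : s.+1%:R * ln 2%:R <= S.+1%:R * 2 :> R by apply: ler_pM.
  rewrite -[s.+1]addn1 natrD; move: lnMH lnH epsH => h1 h2 h3 h4.
  have := ler_wpM2r (ltW n0R) h4; nra.
have : ln t%:R <= ln N%:R + s%:R * ln Z%:R :> R.
  have pos : (0 < \prod_(p <- ps) (p.-1 %/ b))%N.
    by rewrite big_seq prodn_cond_gt0 // => p /quo[].
  rewrite /t ln_natM // lerD // ?ler_ln_nat // -ln_natX // ler_ln_nat //.
  by apply: prod_le => p /quo[].
move=> ht; apply: le_trans ht _; rewrite -(ler_pM2r n0R).
have h5 : s%:R * (n0%:R * ln Z%:R) <= s%:R * ln N%:R :> R by rewrite ler_wpM2l.
have h6 : 0 <= S.+1%:R * n0%:R :> R by rewrite mulr_ge0.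
have h7 : ln 2%:R * n0%:R <= 2 * n0%:R :> R by rewrite ler_wpM2r.
rewrite {1}lnN; move: lnMH lnH epsH lnsN h5 h6 h7; clear; nra.
Qed.

End SmoothModulus.

(** * Reduction modulo p and counting *)

Section Reduction.
Variables (L : fieldExtType rat) (f : {poly int}) (t : L).
Hypothesis f_monic : f \is monic.
Hypothesis f_irr : irreducible_poly (map_poly intr f : {poly rat}).
Hypothesis f_root : root (map_poly intr f) t.
Variables (F : fieldType) (rho : F).
Hypothesis rho_root : root (map_poly intr f) rho.

(** G(t) = 0 forces f to divide G over Q, otherwise Bezout at t gives 0 = 1; as f is monic the
    quotient is integral, so G vanishes at [rho]. *)
Lemma ker_reduction (G : {poly int}) :
  (map_poly intr G).[t] = 0 -> (map_poly intr G).[rho] = 0.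
Proof.
have mapZ (q : {poly int}) : map_poly (in_alg L) (map_poly intr q) = map_poly intr q.
  by rewrite -map_poly_comp; apply: eq_map_poly => z; rewrite /= -in_alg_int.
move=> Gt; suff : f %| G.
  rewrite Pdiv.Idomain.dvdp_eq (monicP f_monic) expr1n scale1r => /eqP ->.
  by rewrite rmorphM hornerM (rootP rho_root) mulr0.
rewrite -dvdp_rat_int; apply/negPn/negP => ndv.
have : coprimep (map_poly intr f : {poly rat}) (map_poly intr G).
  rewrite /coprimep; apply/negPn/negP => sz; have [_ irr2] := f_irr.
  have := irr2 _ sz (dvdp_gcdl _ _) => e; case/negP: ndv.
  by rewrite -(eqp_dvdl _ e) dvdp_gcdr.
case/Bezout_eq1_coprimepP => [[u v]] /= /(congr1 (fun q => (map_poly (in_alg L) q).[t])).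
rewrite rmorphD !rmorphM /= !mapZ hornerD !hornerM (rootP f_root) Gt !mulr0 addr0.
by rewrite rmorph1 hornerC => /esym/eqP; rewrite oner_eq0.
Qed.

(* The reduction map t |-> rho, as a relation: it is only defined on elements with
   a denominator prime to the characteristic. *)
Definition reduces (y : L) (c : F) : Prop := exists (D : int) (G : {poly int}),
  [/\ D%:~R != 0 :> F, D%:~R * y = (map_poly intr G).[t] & D%:~R * c = (map_poly intr G).[rho]].

Lemma reduces0 c : reduces 0 c -> c = 0.
Proof.
move=> [D [G [D0]]]; rewrite mulr0 => /esym/ker_reduction -> /eqP.
by rewrite mulf_eq0 (negPf D0) => /eqP.
Qed.

Lemma reduces_int (z : int) : reduces z%:~R z%:~R.
Proof.
by exists 1, z%:P; rewrite !map_polyC !hornerC /= !mul1r oner_eq0.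
Qed.

Lemma reducesD x y a b : reduces x a -> reduces y b -> reduces (x + y) (a + b).
Proof.
move=> [D [G [D0 Dx Da]]] [E [J [E0 Ey Eb]]].
exists (D * E), (E%:P * G + D%:P * J); split.
- by rewrite rmorphM mulf_neq0.
- rewrite !rmorphD !rmorphM /= !map_polyC /= hornerD !hornerM !hornerC -Dx -Ey; ring.
- rewrite !rmorphD !rmorphM /= !map_polyC /= hornerD !hornerM !hornerC -Da -Eb; ring.
Qed.

Lemma reducesM x y a b : reduces x a -> reduces y b -> reduces (x * y) (a * b).
Proof.
move=> [D [G [D0 Dx Da]]] [E [J [E0 Ey Eb]]].
exists (D * E), (G * J); split.
- by rewrite rmorphM mulf_neq0.
- rewrite !rmorphM /= !hornerM -Dx -Ey; ring.
- rewrite !rmorphM /= !hornerM -Da -Eb; ring.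
Qed.

Lemma reduces_sum (I : Type) (s : seq I) (x : I -> L) (a : I -> F) :
  (forall i, reduces (x i) (a i)) -> reduces (\sum_(i <- s) x i) (\sum_(i <- s) a i).
Proof.
move=> h; apply: (big_rec2 reduces); first exact: (reduces_int 0).
by move=> i u v _; apply: reducesD.
Qed.

Lemma reduces_prod (I : Type) (s : seq I) (x : I -> L) (a : I -> F) :
  (forall i, reduces (x i) (a i)) -> reduces (\prod_(i <- s) x i) (\prod_(i <- s) a i).
Proof.
move=> h; apply: (big_rec2 reduces); first exact: (reduces_int 1).
by move=> i u v _; apply: reducesM.
Qed.

Lemma reduces_inj x a b : reduces x a -> reduces x b -> a = b.
Proof.
move=> xa xb; apply/eqP; rewrite -subr_eq0; apply/eqP/reduces0.
rewrite -(subrr x) -[- x]mulN1r -[- b]mulN1r; apply: reducesD => //.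
by apply: reducesM => //; apply: (reduces_int (-1)).
Qed.

Lemma reducesV x a b : x != 0 -> reduces x a -> reduces x^-1 b -> a != 0 /\ b = a^-1.
Proof.
move=> x0 xa xb; have ab : a * b = 1.
  apply: (@reduces_inj 1); last exact: (reduces_int 1).
  by rewrite -(divff x0); apply: reducesM.
have a0 : a != 0 by apply: contra_eq_neq ab => ->; rewrite mul0r eq_sym oner_eq0.
by split=> //; apply: (mulfI a0); rewrite ab divff.
Qed.

Lemma reduces_exp x a b (e : int) : x != 0 -> reduces x a -> reduces x^-1 b ->
  reduces (x ^ e) (a ^ e).
Proof.
move=> x0 xa xb; have [a0 bE] := reducesV x0 xa xb.
have nat_exp y c m : reduces y c -> reduces (y ^+ m) (c ^+ m).
  move=> yc; elim: m => [|m IH]; first exact: (reduces_int 1).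
  by rewrite !exprS; apply: reducesM.
case: e => m; first exact: nat_exp.
by rewrite !NegzE -!exprz_inv -bE; apply: (nat_exp _ _ m.+1).
Qed.

End Reduction.

Lemma reduces_exists (L : fieldExtType rat) (t : L) (y : L) :
  (exists (D : int) (G : {poly int}), D != 0 /\ D%:~R * y = (map_poly intr G).[t]) ->
  exists z0, forall p, prime p -> (z0 < p)%N -> forall rho : 'F_p, exists c, reduces t rho y c.
Proof.
move=> [D [G [D0 Dy]]]; exists `|D|%N => p pp Dp rho.
have DF : D%:~R != 0 :> 'F_p.
  rewrite -(dvdz_pcharf (pchar_Fp pp)) dvdzE absz_nat gtnNdvd //.
  by rewrite absz_gt0.
by exists ((map_poly intr G).[rho] / D%:~R), D, G; rewrite mulrCA divff ?mulr1.
Qed.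

Lemma reduces_exists_family (L : fieldExtType rat) (t : L) m (y : 'I_m -> L) :
  (forall y : L, exists (D : int) (G : {poly int}), D != 0 /\ D%:~R * y = (map_poly intr G).[t]) ->
  exists z0, forall p, prime p -> (z0 < p)%N -> forall rho : 'F_p, forall i,
    exists c, reduces t rho (y i) c.
Proof.
move=> gen; elim: m y => [|m IH] y; first by exists 0%N => p _ _ rho [].
have [z1 h1] := IH (fun i => y (lift ord0 i)).
have [z2 h2] := reduces_exists (gen (y ord0)).
exists (maxn z1 z2) => p pp; rewrite gtn_max => /andP[p1 p2] rho i.
by case: (unliftP ord0 i) => [j|] ->; [apply: h1 | apply: h2].
Qed.

Lemma expz_Fp (p : nat) (x : 'F_p) (e : int) : prime p -> x != 0 ->
  (p.-1 %| e)%Z -> x ^ e = 1.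
Proof.
move=> pp x0 /dvdzP[q ->]; have xp : x ^+ p.-1 = 1.
  apply: (mulfI x0); rewrite -exprS prednK ?prime_gt0 // mulr1.
  by rewrite -{2}[x]expf_card card_Fp.
by rewrite mulrC -exprz_exp -exprnP xp exp1rz.
Qed.

Section Counting.
Variables (L : fieldExtType rat) (f : {poly int}) (t : L).
Hypothesis f_monic : f \is monic.
Hypothesis f_irr : irreducible_poly (map_poly intr f : {poly rat}).
Hypothesis f_root : root (map_poly intr f) t.
Variables (r k H : nat) (g : 'I_r -> L) (w : 'I_(\dim {:L}%VS) -> L).
Variables (j0 : 'I_k) (i0 : 'I_(\dim {:L}%VS)).
Hypothesis g0 : forall l, g l != 0.
Hypothesis w0 : w i0 != 0.
Local Notation conf := {ffun 'I_k -> {ffun 'I_(\dim {:L}%VS) -> 'I_(2 * H).+1}}.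

(** The inverses are included so that the generators and the pivot [w i0] reduce to nonzero
    values. *)
Definition reducible_at (p : nat) : Prop := forall rho : 'F_p,
  [/\ forall i, exists c, reduces t rho (w i) c, forall l, exists c, reduces t rho (g l) c,
      forall l, exists c, reduces t rho (g l)^-1 c & exists c, reduces t rho (w i0)^-1 c].

Definition solves (v : conf) (e : 'I_k -> 'I_r -> int) : Prop :=
  \sum_j elemA w (v j) * \prod_l g l ^ e j l = 0.

(** By Fermat both solutions satisfy the same linear equation over F_p. In the difference only the
    pivot coordinate survives, with a nonzero coefficient. *)
Lemma pivot_dvd (p : nat) (v v' : conf) (e e' : 'I_k -> 'I_r -> int) :
  prime p -> has_root_mod f p -> reducible_at p ->
  (forall j l, (p.-1 %| e j l - e' j l)%Z) ->
  solves v e -> solves v' e' ->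
  (forall j i, (j, i) != (j0, i0) -> v j i = v' j i) ->
  (p %| (v j0 i0 : nat)%:Z - (v' j0 i0 : nat)%:Z)%Z.
Proof.
move=> pp /existsP[rho rhoP] /(_ rho)[/choice[om omP] /choice[ga gaP] /choice[gai gaiP] [omi omiP]].
move=> ee sv sv' agree.
have ga0 l : ga l != 0.
  by have [] := reducesV f_monic f_irr f_root rhoP (g0 l) (gaP l) (gaiP l).
have om0 : om i0 != 0.
  by have [] := reducesV f_monic f_irr f_root rhoP w0 (omP i0) omiP.
pose Ga (e : 'I_k -> 'I_r -> int) j := \prod_l ga l ^ e j l.
have GaE j : Ga e j = Ga e' j.
  apply: eq_bigr => l _; rewrite -[e j l](subrK (e' j l)).
  by rewrite expfzDr // (expz_Fp pp) // ?mul1r // ee.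
have red (v1 : conf) e1 : solves v1 e1 ->
    \sum_j (\sum_i ((v1 j i : nat)%:Z - H%:Z)%:~R * om i) * Ga e1 j = 0.
  move=> s1; apply: (reduces0 f_monic f_irr f_root rhoP).
  rewrite -s1; apply: reduces_sum => j; apply: reducesM.
    by apply: reduces_sum => i; apply: reducesM; [apply: reduces_int | apply: omP].
  by apply: reduces_prod => l; apply: (reduces_exp f_monic f_irr f_root rhoP) => //.
have := red _ _ sv; have := red _ _ sv' => s' s.
have : \sum_j (\sum_i ((v j i : nat)%:Z - (v' j i : nat)%:Z)%:~R * om i) * Ga e j = 0.
  transitivity (\sum_j (\sum_i ((v j i : nat)%:Z - H%:Z)%:~R * om i) * Ga e j -
    \sum_j (\sum_i ((v' j i : nat)%:Z - H%:Z)%:~R * om i) * Ga e' j); last by rewrite s s' subrr.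
  rewrite -sumrB; apply: eq_bigr => j _.
  rewrite -GaE -mulrBl -sumrB; congr (_ * _); apply: eq_bigr => i _.
  by rewrite -mulrBl -rmorphB /=; congr (_%:~R * _); ring.
rewrite (bigD1 j0) //= [X in _ + X]big1 ?addr0; last first.
  move=> j jj; rewrite big1 ?mul0r // => i _.
  by rewrite agree ?subrr ?mul0r // xpair_eqE (negPf jj).
rewrite (bigD1 i0) //= [X in _ + X]big1 ?addr0; last first.
  move=> i ii; by rewrite agree ?subrr ?mul0r // xpair_eqE (negPf ii) andbF.
move=> /eqP; rewrite !mulf_eq0 (negPf om0) orbF => /orP[|].
  by rewrite -(dvdz_pcharf (pchar_Fp pp)).
by rewrite prodf_seq_eq0 => /hasP[l _ /=]; rewrite expfz_eq0 (negPf (ga0 l)) andbF.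
Qed.

Lemma prod_primes_dvdz (ps : seq nat) (z : int) : uniq ps -> all prime ps ->
  {in ps, forall p : nat, (p %| z)%Z} -> ((\prod_(p <- ps) p)%N %| z)%Z.
Proof.
elim: ps => [|p s IH] /=; first by rewrite big_nil dvd1z.
move=> /andP[ps us] /andP[pp sp] dv; rewrite big_cons dvdzE absz_nat Gauss_dvd.
  have := dv p (mem_head _ _); rewrite dvdzE absz_nat => ->.
  have := IH us sp; rewrite dvdzE absz_nat; apply=> q qs; apply: dv.
  by rewrite inE qs orbT.
elim: s ps sp {us IH dv} => [|q s IH]; first by rewrite big_nil coprimen1.
rewrite inE negb_or /= big_cons coprimeMr => /andP[pq pt] /andP[pq' tp].
by rewrite IH // andbT prime_coprime // dvdn_prime2.
Qed.

(** A solution is determined by its exponents modulo T, the block of length m containing its pivot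
    coordinate, and its other coordinates: these fix the pivot modulo m by [pivot_dvd]. *)
Lemma Zk_bound (ps : seq nat) (T : nat) : (0 < T)%N -> uniq ps -> all prime ps ->
  {in ps, forall p, has_root_mod f p} -> {in ps, forall p, reducible_at p} ->
  {in ps, forall p, (p.-1 %| T)%N} ->
  (Zk w g k H <= T ^ (k * r) *
     (((2 * H) %/ \prod_(p <- ps) p).+1 * (2 * H).+1 ^ (\dim {:L} * k).-1))%N.
Proof.
move=> T0 ups pps rps redps dps; set m := (\prod_(p <- ps) p)%N.
pose F (v : conf) : {ffun 'I_k -> L} := [ffun j => elemA w (v j)].
pose sol := [pred v : conf | `[< solvable_in g (F v) >]].
have cZ : (Zk w g k H <= #|sol|)%N.
  rewrite /Zk; apply: leq_trans (size_undup _) _.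
  rewrite size_filter count_map -size_filter cardE /= {2}/enum_mem.
  by rewrite /enum_mem size_filter count_filter size_filter; apply: sub_count => v /= /andP[].
apply: leq_trans cZ _.
(* One exponent family is fixed for each solvable tuple; the zero family for the others is a mere
   default. *)
have exE (v : conf) : exists e, v \in sol -> solves v e.
  have [/asboolP[tt [ttg tt0]]|nv] := boolP (v \in sol); last by exists (fun _ _ => 0).
  have [e eP] := choice ttg; exists e => _; rewrite /solves -[RHS]tt0.
  by apply: eq_bigr => j _; rewrite ffunE -eP.
have [E EP] := choice exE.
pose PJ := {x : 'I_k * 'I_(\dim {:L}%VS) | x != (j0, i0)}.
pose phi (v : conf) := ([ffun x : 'I_k * 'I_r => inord (absz (E v x.1 x.2 %% T)%Z) : 'I_T.-1.+1],
  (inord (v j0 i0 %/ m) : 'I_((2 * H) %/ m).+1,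
   [ffun x : PJ => v (val x).1 (val x).2])).
have phi_inj : {in sol &, injective phi}.
  move=> v v' /EP sv /EP sv' [/ffunP eE dE /ffunP vE].
  have agree j i : (j, i) != (j0, i0) -> v j i = v' j i.
    by move=> ji; have := vE (exist _ (j, i) ji : PJ); rewrite !ffunE.
  have TZ : T%:Z != 0 by rewrite -lt0n.
  have modlt (z : int) : (absz (z %% T)%Z < T.-1.+1)%N.
    by rewrite prednK // -ltz_nat gez0_abs ?modz_ge0 // ltz_pmod // ltz_nat.
  have econg j l : (T %| E v j l - E v' j l)%Z.
    have := eE (j, l); rewrite !ffunE /= => /(congr1 val); rewrite /= !inordK // => h.
    rewrite -eqz_mod_dvd; apply/eqP.
    by rewrite -[LHS]gez0_abs ?modz_ge0 // -[RHS]gez0_abs ?modz_ge0 // h.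
  have dv p : p \in ps -> (p %| (v j0 i0 : nat)%:Z - (v' j0 i0 : nat)%:Z)%Z.
    move=> pps'; apply: (pivot_dvd (allP pps p pps') (rps p pps') (redps p pps') _ sv sv' agree).
    by move=> j l; apply: dvdz_trans (econg j l); rewrite dvdzE !absz_nat dps.
  have mdv := prod_primes_dvdz ups pps dv.
  have veq : v j0 i0 = v' j0 i0.
    apply: val_inj; move: dE mdv => /(congr1 val); rewrite /= !inordK.
    - rewrite -/m => dE; rewrite -eqz_mod_dvd !modz_nat => /eqP[modE].
      by rewrite (divn_eq (v j0 i0) m) (divn_eq (v' j0 i0) m) dE modE.
    - by rewrite ltnS leq_div2r // -ltnS.
    - by rewrite ltnS leq_div2r // -ltnS.
  apply/ffunP => j; apply/ffunP => i.
  by have [[-> ->]|] := eqVneq (j, i) (j0, i0); [exact: veq | exact: agree].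
rewrite -(card_in_image phi_inj); apply: leq_trans (max_card _) _.
rewrite !card_prod !card_ffun card_prod !card_ord prednK // card_sig.
by rewrite (cardC1 (j0, i0)) card_prod !card_ord [(k * \dim _)%N]mulnC.
Qed.

End Counting.

(** * The final estimate *)

Lemma integral_basis_neq0 (L : fieldExtType rat) (w : 'I_(\dim {:L}%VS) -> L) :
  integral_basis w -> exists i, w i != 0.
Proof.
(* Were all [w i] zero, the algebraic integer 1 would be zero. *)
move=> wP; have int1 : is_alg_int (1 : L).
  exists ('X - 1%:P); rewrite monicXsubC; split=> //.
  by rewrite rmorphB /= map_polyX map_polyC /= root_XsubC.
have [u uE] := (wP 1).1 int1.
case: (boolP [exists i, w i != 0]) => [/existsP //|/existsPn no].
move/eqP: uE; rewrite big1 ?oner_eq0 // => i _.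
by have /negPn/eqP -> := no i; rewrite mulr0.
Qed.

(** Since m <= H, (2H/m + 1) m <= 3H, whence Zk m <= T^(kr) (3H)^(dk); take logarithms with m nearly
    H and T a small power of H. *)
Lemma ln_Zk_le (R : realType) (L : fieldExtType rat) (r : nat) (g : 'I_r -> L)
    (w : 'I_(\dim {:L}%VS) -> L) (k : nat) :
  (forall i, g i != 0) -> integral_basis w -> (0 < k)%N ->
  forall eps : R, 0 < eps -> exists H0 : nat, forall H, (H0 <= H)%N ->
    ln (Zk w g k H)%:R <= ((\dim {:L}%VS * k)%N%:R - 1 + eps) * ln H%:R.
Proof.
move=> g0 wb k0 eps eps0.
have [i0 w0] := integral_basis_neq0 wb.
have [n [C [t [dimE irr root_t gen]]]] := integral_generator L.
have [z1 hz1] := reduces_exists_family w gen.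
have [z2 hz2] := reduces_exists_family g gen.
have [z3 hz3] := reduces_exists_family (fun l => (g l)^-1) gen.
have [z4 hz4] := reduces_exists (gen (w i0)^-1).
pose z0 := maxn (maxn z1 z2) (maxn z3 z4).
(* The kr factors T and the loss in m cost (kr + 1) e1 = eps / 2; the other half of [eps] absorbs dk
   ln 3. *)
pose e1 := eps / (2 * (k * r).+1%:R).
have e10 : 0 < e1 by rewrite divr_gt0 // mulr_gt0.
have [H1 modulus] := smooth_modulus irr z0 e10.
pose dk := (\dim {:L}%VS * k)%N.
have dk0 : (0 < dk)%N by rewrite muln_gt0 k0 dimE.
have [H2 hH2] := ln_nat_unbounded (2 * (dk%:R * ln 3%:R) / eps : R).
exists (maxn 1 (maxn H1 H2)) => H; rewrite !geq_max => /and3P[Hp /modulus].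
move=> [ps [T [[ups pps rps zps] T0 dps mH [lnm lnT]]]] /hH2 lnH.
set m := (\prod_(p <- ps) p)%N in mH lnm.
have m0 : (0 < m)%N by rewrite /m big_seq prodn_cond_gt0 // => p /(allP pps)/prime_gt0.
have redps p : p \in ps -> reducible_at t g w i0 p.
  move=> ips rho; have := allP zps p ips; rewrite !gtn_max => /andP[/andP[p1 p2] /andP[p3 p4]].
  have pp := allP pps p ips.
  by split; [exact: hz1 | exact: hz2 | exact: hz3 | exact: hz4].
have := @Zk_bound L (char_poly C) t (char_poly_monic C) irr root_t r k H g w
  (Ordinal k0) i0 g0 w0 ps T T0 ups pps (fun p => allP rps p) redps dps.
rewrite -/m => ZB.
have lnH0 := ln_nat_ge0 R H.
(* For Zk = 0 the convention ln 0 = 0 leaves a nonnegative right side to check, by dk >= 1. *)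
have [Z0|Z0] := posnP (Zk w g k H).
  rewrite Z0 ln0 // mulr_ge0 // addr_ge0 ?(ltW eps0) // subr_ge0 ler1n //.
have H30 : (0 < 3 * H)%N by rewrite muln_gt0.
have ZB2 : (Zk w g k H * m <= T ^ (k * r) * (3 * H) ^ dk)%N.
  apply: leq_trans (leq_mul ZB (leqnn m)) _.
  rewrite -mulnA leq_mul2l; apply/orP; right.
  rewrite -(prednK dk0) [((3 * H) ^ _)%N]expnS /= mulnAC leq_mul //.
    by rewrite mulSn -[3%N]/(1 + 2)%N mulnDl mul1n leq_add //; exact: leq_trunc_div.
  case: (dk.-1) => // j; rewrite leq_exp2r // -[3%N]/(2 + 1)%N mulnDl mul1n -addn1.
  by rewrite leq_add2l.
have : ln (Zk w g k H * m)%N%:R <= ln (T ^ (k * r) * (3 * H) ^ dk)%N%:R :> R.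
  by rewrite ler_ln_nat // muln_gt0 Z0.
rewrite !ln_natM ?expn_gt0 ?T0 ?H30 // !ln_natX // ln_natM // => main.
have h1 : (k * r)%:R * ln T%:R <= (k * r)%:R * (e1 * ln H%:R) by rewrite ler_wpM2l.
have h2 : (k * r)%:R * (e1 * ln H%:R) + e1 * ln H%:R = eps / 2 * ln H%:R.
  rewrite -[X in _ + X]mul1r -mulrDl natr1 /e1.
  have : 0 < (k * r).+1%:R :> R by [].
  by move: (_.+1%:R) => x x0; field; rewrite gt_eqF.
have h3 : dk%:R * ln 3%:R <= eps / 2 * ln H%:R.
  by move: lnH; rewrite ler_pdivrMr //; lra.
rewrite -/dk; lra.
Qed.

(** Carries the logarithmic bound over to the power function of the standard reals; m = 0 is
    separate because ln 0 = 0 cannot be exponentiated back. *)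
Lemma Rle_Rpower_ln (m H : nat) (y : Rdefinitions.R) :
  ln (m%:R : Rdefinitions.R) <= y * ln H%:R ->
  Rdefinitions.Rle (Raxioms.INR m) (Rpower.Rpower (Raxioms.INR H) y).
Proof.
move=> lnm; rewrite /Rpower.Rpower RexpE RlnE !INRE; apply/RleP.
have [->|m0] := posnP m; first exact: expR_ge0.
by rewrite -[m%:R]lnK ?ler_expR // posrE ltr0n.
Qed.

End LinearEquationsInGroups.

From Stdlib Require Import Reals.

Theorem theorem2p1 (L : fieldExtType rat) (r : nat) (g : 'I_r -> L)
  (w : 'I_(\dim {:L}%VS) -> L) (k : nat) :
  (forall i, g i != GRing.zero) ->
  integral_basis w ->
  (1 <= k)%N ->
  forall eps : R, Rlt 0 eps ->
  exists H0 : nat, forall H : nat, (H0 <= H)%N ->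
    Rle (INR (Zk w g k H))
        (Rpower (INR H) (Rplus (Rminus (INR (\dim {:L}%VS * k)) 1) eps)).
Proof.
move=> g0 wb k0 eps /RltP eps0.
have [H0 bound] := ln_Zk_le g0 wb k0 eps0.
exists H0 => H /bound lnZ; apply: Rle_Rpower_ln.
by rewrite INRE.
Qed.
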